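(* Let $N\ge 2$ be an integer, let $\chi$ be an even Dirichlet character modulo $N$ (that is, $\chi(-1)=1$), and let $n\ge 1$ be an integer. Then $$L(2n,\chi)=\frac{\pi^{2n}}{2(2n-1)!\,N^{2n}}\sum_{i=1}^{n}a_{n,i}\,L_{\mathbb{Z}/N\mathbb{Z}}(i,\chi)$$ and $$L_{\mathbb{Z}/N\mathbb{Z}}(n,\chi)=2\sum_{i=1}^{n}c_{n,i}\frac{N^{2i}}{\pi^{2i}}L(2i,\chi).$$ Here $c_{n,i}$ is the coefficient of $x^{-2i}$ in the Laurent expansion of $(\sin x)^{-2n}$ at $x=0$, and the numbers $a_{n,i}$, $1\le i\le n$, given by $$a_{n,i}=2\sum_{l=1}^{i}(-1)^{n-l}\,t(n-l,n-i)\,\overline{A}(2n,l),$$ satisfy $$\sum_{i=0}^{n-s}a_{n,n-i}\,c_{n-i,s}=\begin{cases}(2n-1)! & \text{if } s=n,\\ 0 & \text{if } 1\le s\le n-1.\end{cases}$$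
   Context: A Dirichlet character modulo $N$ is a homomorphism $\chi:(\mathbb{Z}/N\mathbb{Z})^\times\to\mathbb{C}^\times$, extended to $\mathbb{Z}$ by $\chi(m)=0$ if $\gcd(m,N)>1$; it need not be primitive. $L(s,\chi)=\sum_{k=1}^\infty \chi(k)k^{-s}$ is the Dirichlet $L$-function. The $L$-function of the cycle graph $\mathbb{Z}/N\mathbb{Z}$ is $$L_{\mathbb{Z}/N\mathbb{Z}}(s,\chi)=\sum_{m=1}^{N-1}\frac{\chi(m)}{\sin^{2s}(m\pi/N)}.$$ For integers $0\le i\le k$ with $k\ge1$, $t(k,i)=(-1)^{k-i}2^{2i}\frac{k}{k+i}\binom{k+i}{k-i}$, and by convention $t(0,0)=\frac12$. A circular $n$-permutation is an arrangement $\sigma=(\sigma(1),\dots,\sigma(n))$ of $\{1,\dots,n\}$ on a circle, considered up to rotation; with $\sigma(n+1)=\sigma(1)$, a descent of $\sigma$ is an entry $\sigma(i)$, $1\le i\le n$, with $\sigma(i)>\sigma(i+1)$. $\overline{A}(n,l)$ denotes the number of circular $n$-permutations with exactly $l$ descents. *)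

(* Defs.v *)
From mathcomp Require Export all_boot all_order all_algebra all_fingroup.
From mathcomp Require Export all_classical all_reals all_analysis.
From mathcomp Require Export complex.

Set Implicit Arguments.
Unset Strict Implicit.
Unset Printing Implicit Defensive.

Import Order.TTheory GRing.Theory Num.Theory.
Import numFieldTopology.Exports numFieldNormedType.Exports.

Local Open Scope classical_set_scope.
Local Open Scope ring_scope.
Local Open Scope complex_scope.

(* 'Z_N is the ring of integers modulo N only for 1 < N. *)
Record dirichlet_char (N : nat) (C : fieldType) := DirichletChar {
  dchar_fun : {unit 'Z_N} -> C;
  dchar_neq0 : forall u, dchar_fun u != 0;
  dcharM : forall u v, dchar_fun (u * v)%g = dchar_fun u * dchar_fun v
}.

(* The default value 1 of insubd is never used when 1 < N: m is then a unit
   modulo N exactly when it is coprime to N. *)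
Definition dchar_ext (N : nat) (C : fieldType) (chi : dirichlet_char N C)
    (m : int) : C :=
  if coprimez m N then dchar_fun chi (insubd (1%g : {unit 'Z_N}) m%:~R)
  else 0.

Coercion dchar_ext : dirichlet_char >-> Funclass.

Definition dchar_even (N : nat) (C : fieldType) (chi : dirichlet_char N C) :=
  chi (-1) = 1.

Section LFunctions.
Variables (R : realType) (N : nat) (chi : dirichlet_char N R[i]).

(* L(s, chi) at natural arguments s.  The alias R[i]^o carries the topology
   of the complex modulus. *)
Definition dirichlet_L (s : nat) : R[i] :=
  limn (fun m => \sum_(1 <= k < m) (chi k / k%:R ^+ s : R[i]^o)).

Definition cycle_L (s : nat) : R[i] :=
  \sum_(1 <= m < N) chi m / (sin (m%:R * pi / N%:R : R) ^+ (2 * s))%:C.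

End LFunctions.

Section LaurentExpansion.
Variable R : realType.
Implicit Types (f : R -> R) (d : int -> R).

(* f x is the sum of d_j x^j over j >= - M, for all small nonzero x. *)
Definition laurent_expansion f d : Prop :=
  exists M : nat,
    (forall j : int, j < - M%:Z -> d j = 0) /\
    \forall x \near 0^',
      series (fun k : nat => d (k%:Z - M%:Z) * x ^ (k%:Z - M%:Z)) @ \oo --> f x.

Definition laurent_coef f (j : int) : R :=
  (get [set d | laurent_expansion f d] : int -> R) j.

Definition c_coef (n i : nat) : R :=
  laurent_coef (fun x => sin x ^- (2 * n)) (- (2 * i)%:Z).

End LaurentExpansion.

Section CircularPermutations.
Variable n : nat.

(* s i > s (i + 1), indices being taken modulo n. *)
Definition cdescents (s : 'S_n) : nat := #|[set i : 'I_n | s (ordS i) < s i]%N|.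

Definition rotation : 'S_n := perm (@ordS_inj n).

(* (r * s) i = s (r i), so the arrangements obtained from s by rotating the
   circle form the right coset of s. *)
Definition circular_perm (s : 'S_n) : {set 'S_n} := (<[rotation]> :* s)%g.

Definition circular_eulerian (l : nat) : nat :=
  #|[set circular_perm s | s : 'S_n & cdescents s == l]|.

End CircularPermutations.

Section ACoefficients.
Variable F : fieldType.

Definition t_coef (k i : nat) : F :=
  if k == 0%N then 2^-1
  else (-1) ^+ (k - i) * 2 ^+ (2 * i) * (k%:R / (k + i)%:R)
       * 'C(k + i, k - i)%:R.

Definition a_coef (n i : nat) : F :=
  2 * \sum_(1 <= l < i.+1)
        (-1) ^+ (n - l) * t_coef (n - l) (n - i)
        * (circular_eulerian (2 * n) l)%:R.

End ACoefficients.

(* Main.v *)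
(* Write A(m,l) for the number of circular m-permutations with l descents and
   let G_m be (-1)^(m-1) times the derivative of order m-1 of the cotangent.
   Inserting the largest value into a circular permutation gives
     A(m+1,l) = l A(m,l) + (m-l+1) A(m,l-1),
   which is exactly what G_m' = - G_(m+1) requires of the numerators in
     G_m(x) = (sum_l A(m,l) cos((2l-m)x)) / sin(x)^m.
   For m = 2n the symmetry of A(2n,.) and the expansion of cos(2kx) in powers of
   sin(x)^2 turn this into G_2n = sum_i a_{n,i} / sin^(2i).
   Differentiating cot x = (cot(x/2) + cot((x-pi)/2)) / 2 yields
     G_m(x) = 2^(-m) (G_m(x/2) + G_m((x-pi)/2)).
   Iterated at x = m pi/N and summed against the even character chi, this
   becomes a sum over j < N 2^r of chi(j) times a term tending to
   (2n-1)! (j pi/N)^(-2n); dominated convergence gives the first formula.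
   Iterated near 0, it shows that G_2n(x) - (2n-1)! x^(-2n) is bounded, so that
   comparing principal parts of Laurent expansions gives the relation between
   the a_{n,i} and the c_{n,s}; inverting this triangular relation gives the
   second formula. *)
Require Import Defs.
From mathcomp Require Import cyclic zify ring lra.
Set Implicit Arguments.
Unset Strict Implicit.
Unset Printing Implicit Defensive.
Import Order.TTheory GRing.Theory Num.Theory.
Import numFieldTopology.Exports numFieldNormedType.Exports.
Local Open Scope ring_scope.

(** * Circular permutations *)

Lemma cdescents_sum n (s : 'S_n) :
  cdescents s = (\sum_(i < n) (s (ordS i) < s i))%N.
Proof.
rewrite /cdescents -sum1_card big_mkcond; apply: eq_bigr => i _.
by rewrite (_ : (i \in _) = (s (ordS i) < s i)%N); [case: ltnP|exact: asboolb].
Qed.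

Lemma cdescents_rotation n (s : 'S_n) :
  cdescents (rotation n * s)%g = cdescents s.
Proof.
rewrite !cdescents_sum [RHS](reindex_inj (@ordS_inj n)).
by apply: eq_bigr => i _; rewrite !permM !permE.
Qed.

Lemma rotation_expE n k (i : 'I_n) :
  ((rotation n ^+ k)%g : 'S_n) i = ((i + k) %% n)%N :> nat.
Proof.
elim: k => [|k IHk]; first by rewrite perm1 addn0 modn_small.
by rewrite expgSr permM permE /= IHk -addn1 modnDml addn1 addnS.
Qed.

Lemma order_rotation n : #[rotation n.+1]%g = n.+1.
Proof.
apply/eqP; rewrite eqn_dvd order_dvdn; apply/andP; split.
  apply/eqP/permP => i; apply: val_inj.
  by rewrite /= rotation_expE perm1 modnDr modn_small.
have /permP/(_ ord0)/(congr1 val) := expg_order (rotation n.+1).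
by rewrite /= rotation_expE perm1 /= add0n => /eqP.
Qed.

(** Descents are constant on the cosets of the rotation group, and each coset has n + 1 elements. *)
Lemma card_cdescents n l :
  #|[set s : 'S_n.+1 | cdescents s == l]| = (n.+1 * circular_eulerian n.+1 l)%N.
Proof.
set D := [set s | _].
have rotD k s : (cdescents (rotation n.+1 ^+ k * s)%g == l) = (cdescents s == l).
  by elim: k => [|k IHk]; rewrite ?mul1g // expgS -mulgA cdescents_rotation.
have Dsub A : A \in @circular_perm n.+1 @: D -> A \subset D.
  case/imsetP => s; rewrite inE => sD ->; apply/fintype.subsetP => _ /rcosetP[_ /cycleP[k ->] ->].
  by rewrite inE rotD.
rewrite /circular_eulerian -/D mulnC; apply: card_uniform_partition.
  by move=> _ /imsetP[s _ ->]; rewrite card_rcoset -orderE order_rotation.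
apply/and3P; split.
- apply/eqP/finset.setP => s; apply/bigcupP/idP => [[A /Dsub/fintype.subsetP]|sD]; first exact.
  by exists (circular_perm s); [exact: imset_f | exact: rcoset_refl].
- have /and3P[_ trH _] := rcosets_partition (finset.subsetT <[rotation n.+1]>%g).
  apply: trivIsetS trH; apply/fintype.subsetP => _ /imsetP[s _ ->].
  by apply/rcosetsP; exists s; rewrite ?inE.
- by apply/imsetP => -[s _ /finset.setP/(_ s)]; rewrite inE rcoset_refl.
Qed.

(* Inserting the largest value right after position q turns that gap into an
   ascent followed by a descent. *)
Lemma cdescents_insert n (s : 'S_n) (q : 'I_n) :
  cdescents (lift_perm (lift ord0 q) ord_max s) =
    (cdescents s + (s q <= s (ordS q)))%N.
Proof.
set p := lift ord0 q; set s' := lift_perm _ _ _.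
have liftS j : ordS (lift p j) = if j == q then p else lift p (ordS j).
  apply: val_inj; case: (eqVneq j q) => [-> | jq] /=.
    by rewrite /bump /= ltnn add0n modn_small ?ltnS.
  have jq' : (val j != val q) by [].
  rewrite /= in jq'; have := ltn_ord j; have := ltn_ord q.
  rewrite /bump /=; case: n s q @p @s' j jq jq' => [|n] s [q qn] p s' [j jn] //= _ jq _ _.
  case: (ltnP j n) => [jn' | nj]; last first.
    have -> : j = n by lia.
    by rewrite modnn (_ : (q < n)%N) ?modnn //; lia.
  rewrite (modn_small (_ : (j.+1 < n.+1)%N)) //.
  by rewrite modn_small; lia.
(* Position [p] carries the largest value and is a descent; the old position [q], now followed by
   it, is none. The other positions keep their status. *)
rewrite !cdescents_sum (bigD1_ord p) //= (bigD1 q) //= [in RHS](bigD1 q) //=.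
rewrite liftS eqxx /s' lift_perm_id lift_perm_lift lift_max.
have -> : (lift_perm p ord_max s (ordS p) < (ord_max : 'I_n.+1))%N.
  have [j ->] : exists j, ordS p = lift p j.
    have : p != ordS p.
      apply/eqP => /(congr1 val) /=; rewrite /bump /= add1n.
      have := ltn_ord q; case: (ltnP q.+1 n) => qn qn'.
        by rewrite modn_small //; lia.
      by rewrite (_ : q.+2 = n.+1) ?modnn //; lia.
    by case/unlift_some => j -> _; exists j.
  by rewrite lift_perm_lift lift_max.
rewrite [X in (_ + (X + _))%N](_ : _ = 0%N); last by rewrite ltnNge ltnW //; apply: ltn_ord.
rewrite [X in (_ + (_ + X))%N](eq_bigr (fun i => (s (ordS i) < s i) : nat)).
  by case: leqP => _ /=; lia.
by move=> j jq; rewrite liftS (negPf jq) !lift_perm_lift !lift_max.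
Qed.

(** Deleting position [p] and value [r] from [s] and closing the gaps leaves a smaller
    permutation. *)
Lemma lift_perm_onto n (p r : 'I_n.+1) (s : 'S_n.+1) :
  s p = r -> exists s', s = lift_perm p r s'.
Proof.
move=> spr.
have neq k : r != s (lift p k).
  by rewrite -spr (inj_eq perm_inj) neq_lift.
pose f k := odflt k (unlift r (s (lift p k))).
have fK k : lift r (f k) = s (lift p k).
  by rewrite /f; have /unlift_some[j ej ->] := neq k.
have f_inj : injective f.
  by move=> j k /(congr1 (lift r)); rewrite !fK => /perm_inj/lift_inj.
exists (perm f_inj); apply/permP => k.
case: (unliftP p k) => [j ->|->]; last by rewrite lift_perm_id.
by rewrite lift_perm_lift permE fK.
Qed.

(* Rotation moves the position of the largest value without changing the
   descents, so each position carries the same share of the n.+1 rotations. *)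
Lemma card_cdescents_at n l (p : 'I_n.+1) :
  #|[set s : 'S_n.+1 | (s p == ord_max) && (cdescents s == l)]| =
  circular_eulerian n.+1 l.
Proof.
pose X p := #|[set s : 'S_n.+1 | (s p == ord_max) && (cdescents s == l)]|.
have XS q : X (ordS q) = X q.
  rewrite /X -[RHS](card_preimset _ (mulgI (rotation n.+1))).
  by apply: eq_card => s; rewrite !inE cdescents_rotation permM permE.
have X0 q : X q = X ord0.
  case: q; elim=> [|k IHk] kn; first by congr X; apply: val_inj.
  rewrite -(IHk (ltnW kn)) -[RHS]XS; congr X; apply: val_inj => /=.
  by rewrite modn_small.
have sumX : (\sum_q X q = n.+1 * circular_eulerian n.+1 l)%N.
  rewrite -card_cdescents -sum1dep_card.
  rewrite (partition_big (fun s : 'S_n.+1 => s^-1%g ord_max) predT) //=.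
  apply: eq_bigr => q _; rewrite /X -sum1dep_card; apply: eq_bigl => s.
  by rewrite andbC (canF_eq (permKV s)) [s q == _]eq_sym.
rewrite -/(X p) X0; apply/eqP; rewrite -(eqn_pmul2l (ltn0Sn n)) -sumX.
by rewrite (eq_bigr _ (fun q _ => X0 q)) sum_nat_const card_ord.
Qed.

(** Double counting of the insertions into [s] after position [q]. By [card_cdescents_at] each [q]
    accounts for A(n+1,l) results with l descents; each [s] yields them at its l descents if it has
    l, and at its n-l+1 ascents if it has l-1. *)
Lemma circular_eulerianS n l : (0 < n)%N ->
  circular_eulerian n.+1 l =
    (l * circular_eulerian n l
     + (if l is k.+1 then (n - k) * circular_eulerian n k else 0))%N.
Proof.
move=> n0; apply/eqP; rewrite -(eqn_pmul2l n0); apply/eqP.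
transitivity (\sum_(q < n) \sum_(s : 'S_n)
    (cdescents s + (s q <= s (ordS q)) == l)%N)%N.
  rewrite -[X in (X * _)%N = _]card_ord -sum_nat_const; apply: eq_bigr => q _.
  rewrite -(card_cdescents_at l (lift ord0 q)).
  transitivity #|[set s : 'S_n | cdescents s + (s q <= s (ordS q)) == l]%N|.
    rewrite -(card_imset _ (_ : injective (lift_perm (lift ord0 q) ord_max))).
      apply: eq_card => s; rewrite inE; apply/andP/imsetP.
        case=> /eqP/lift_perm_onto[s' ->]; rewrite cdescents_insert => sl.
        by exists s'; rewrite ?inE.
      case=> s'; rewrite inE -cdescents_insert => sl ->.
      by rewrite lift_perm_id.
    move=> s t /permP st; apply/permP => k.
    by have := st (lift (lift ord0 q) k); rewrite !lift_perm_lift => /lift_inj.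
  by rewrite -sum1dep_card big_mkcond; apply: eq_bigr => s _; case: (_ == l).
rewrite exchange_big /=.
rewrite (eq_bigr (fun s => l * (cdescents s == l)
   + (if l is k.+1 then (n - k) * (cdescents s == k) else 0)))%N; last first.
  move=> s _.
  have cnt : (\sum_(q < n) (s q <= s (ordS q)) + cdescents s = n)%N.
    rewrite cdescents_sum -big_split /= -[RHS]card_ord -sum1_card.
    by apply: eq_bigr => q _; case: leqP.
  rewrite (eq_bigr (fun q => (s q <= s (ordS q)) * (cdescents s + 1 == l)
      + (s (ordS q) < s q) * (cdescents s == l)))%N; last first.
    by move=> q _; case: leqP => _; rewrite ?addn0 ?mul1n ?mul0n.
  rewrite big_split /= -!big_distrl /= -cdescents_sum addnC.
  congr (_ + _)%N; first by case: eqP => [->|]; rewrite ?muln0.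
  case: l => [|k]; first by rewrite addn1 muln0.
  by rewrite addn1 eqSS; case: eqP => [<-|]; rewrite ?muln0 // -[X in (X - _)%N]cnt addnK.
rewrite big_split /= -big_distrr /= mulnDr.
have card_eq k : (\sum_(s : 'S_n) (cdescents s == k) = n * circular_eulerian n k)%N.
  case: n n0 => // n _.
  rewrite -card_cdescents -sum1dep_card [RHS]big_mkcond /=.
  by apply: eq_bigr => s _; case: eqP.
rewrite card_eq mulnCA; congr (_ + _)%N.
case: l => [|k]; first by rewrite big1 ?muln0.
by rewrite -big_distrr /= card_eq mulnCA.
Qed.

Lemma circular_eulerian1 l : circular_eulerian 1 l = (l == 0%N).
Proof.
rewrite -[LHS]mul1n -card_cdescents.
rewrite (eq_card (B := [pred s | l == 0%N])).
  case: eqP => _; last by rewrite eq_card0.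
  by rewrite cardT -cardE card_Sn.
move=> s; rewrite !inE cdescents_sum big1 1?eq_sym // => i _.
by rewrite (ord1 (ordS i)) (ord1 i) ltnn.
Qed.

Lemma circular_eulerian_ge n l : (0 < n)%N -> (n <= l)%N -> circular_eulerian n l = 0%N.
Proof.
elim: n l => // -[|n] IHn l _ nl; first by rewrite circular_eulerian1; case: l nl.
rewrite circular_eulerianS // IHn ?muln0 //; last exact: ltnW.
by case: l nl => // l nl; rewrite IHn // muln0.
Qed.

Lemma circular_eulerian_n0 n : circular_eulerian n.+2 0 = 0%N.
Proof. by rewrite circular_eulerianS. Qed.

(** The two terms of the recurrence trade places under the reflection of [l]. Sizes start at 2, as
    A(1,0) = 1 but A(1,1) = 0. *)
Lemma circular_eulerian_sym n l : (l <= n.+2)%N ->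
  circular_eulerian n.+2 (n.+2 - l) = circular_eulerian n.+2 l.
Proof.
elim: n l => [|n IHn] l.
  case: l => [|[|[|l]]] // _; rewrite ?subn0 ?subnn circular_eulerian_n0;
  by rewrite circular_eulerian_ge.
rewrite leq_eqVlt => /predU1P[->|ln].
  by rewrite subnn circular_eulerian_n0 circular_eulerian_ge.
case: l ln => [|l] ln; first by rewrite subn0 circular_eulerian_n0 circular_eulerian_ge.
rewrite subSS subSn // (@circular_eulerianS n.+2 l.+1) // (@circular_eulerianS n.+2 _.+1) //.
have e1 : circular_eulerian n.+2 (n.+1 - l) = circular_eulerian n.+2 l.+1.
  exact: (IHn l.+1 ln).
have e2 : circular_eulerian n.+2 (n.+1 - l).+1 = circular_eulerian n.+2 l.
  by rewrite -(subSn (_ : l <= n.+1)%N) ?IHn //; lia.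
rewrite e1 e2 addnC; congr (_ * _ + _ * _)%N; lia.
Qed.

(** This sum is the value of [cot_num] at 0 and also its uniform bound. *)
Lemma sum_circular_eulerian n : (\sum_(l < n.+2) circular_eulerian n.+1 l = n`!)%N.
Proof.
apply/eqP; rewrite -(eqn_pmul2l (ltn0Sn n)) -factS -card_Sn; apply/eqP.
rewrite big_distrr /= -sum1_card.
have cd (s : 'S_n.+1) : (cdescents s < n.+2)%N.
  by rewrite ltnS /cdescents -[X in (_ <= X)%N]card_ord max_card.
rewrite (partition_big (fun s => Ordinal (cd s)) predT) //=.
by apply: eq_bigr => l _; rewrite -card_cdescents -sum1dep_card.
Qed.

(** * Derivatives of the cotangent *)

Section CotangentDerivatives.
Variable R : realType.
Implicit Types x y a b : R.

Definition cot_num (m : nat) x : R :=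
  \sum_(l < m.+1) (circular_eulerian m l)%:R * cos ((2 * l%:R - m%:R) * x).

(* (-1)^(m-1) times the derivative of order m - 1 of the cotangent *)
Definition cot_der (m : nat) x : R := cot_num m x / sin x ^+ m.

Lemma is_derive_affine (f : R -> R) a b x (df : R) :
  is_derive (a * x + b) 1 f df -> is_derive x 1 (fun y => f (a * y + b)) (a * df).
Proof.
move=> fd; rewrite mulrC; apply: (@is_derive1_comp _ f (fun y => a * y + b)) => //.
by apply: is_derive_eq; rewrite addr0 [LHS]mulr1.
Qed.

(* Product formulas for cos and sin turn the recurrence of the circular
   Eulerian numbers into this identity. *)
Lemma cot_numS m x : (0 < m)%N ->
  cot_num m.+1 x = \sum_(l < m.+1) (circular_eulerian m l)%:R *
    ((2 * l%:R - m%:R) * sin ((2 * l%:R - m%:R) * x) * sin x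
      + m%:R * cos ((2 * l%:R - m%:R) * x) * cos x).
Proof.
move=> m0; rewrite /cot_num.
pose c l := cos ((2 * l%:R - m.+1%:R) * x) : R.
have step l : (circular_eulerian m l)%:R *
    ((2 * l%:R - m%:R) * sin ((2 * l%:R - m%:R) * x) * sin x
      + m%:R * cos ((2 * l%:R - m%:R) * x) * cos x) =
    (l * circular_eulerian m l)%:R * c l
    + (m%:R - l%:R) * (circular_eulerian m l)%:R * c l.+1.
  have -> : c l = cos ((2 * l%:R - m%:R) * x) * cos x
      + sin ((2 * l%:R - m%:R) * x) * sin x.
    by rewrite -cosB /c -natr1; congr cos; ring.
  have -> : c l.+1 = cos ((2 * l%:R - m%:R) * x) * cos x
      - sin ((2 * l%:R - m%:R) * x) * sin x.
    by rewrite -cosD /c -!natr1; congr cos; ring.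
  by rewrite natrM; ring.
rewrite [RHS](eq_bigr _ (fun (l : 'I_m.+1) _ => step l)) big_split /=.
rewrite (eq_bigr (fun l : 'I__ => (l * circular_eulerian m l)%:R * c l
   + (if l : nat is k.+1 then (m - k) * circular_eulerian m k else 0)%N%:R * c l)).
  rewrite big_split /= big_ord_recr /= circular_eulerian_ge // muln0 mul0r addr0.
  congr (_ + _); rewrite big_ord_recl /= mul0r add0r.
  apply: eq_bigr => l _; rewrite /bump add1n natrM natrB //.
  by rewrite -ltnS ltn_ord.
by move=> l _; rewrite circular_eulerianS // natrD mulrDl.
Qed.

Lemma is_derive_cot_num m x : is_derive x 1 (cot_num m)
  (- \sum_(l < m.+1) (circular_eulerian m l)%:R *
      ((2 * l%:R - m%:R) * sin ((2 * l%:R - m%:R) * x))).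
Proof.
(* The added 0 puts each argument in the form that [is_derive_affine] expects. *)
rewrite -sumrN (_ : cot_num m = \sum_(l < m.+1)
  (circular_eulerian m l)%:R \*: (fun y => cos ((2 * l%:R - m%:R) * y + 0))); last first.
  by rewrite fct_sumE; apply/funext => y; apply: eq_bigr => l _; rewrite /= addr0.
apply: is_derive_sum => l.
have dcos := is_derive_affine (is_derive_cos ((2 * l%:R - m%:R) * x + 0)).
apply: (is_derive_eq (is_deriveZ (circular_eulerian m l)%:R dcos)).
by rewrite addr0 [LHS]mulrCA; ring.
Qed.

Lemma is_derive_cot_der m x : (0 < m)%N -> sin x != 0 ->
  is_derive x 1 (cot_der m) (- cot_der m.+1 x).
Proof.
move=> m0 sx; have numd := is_derive_cot_num m x.
have sxm : (sin ^+ m) x != 0 by rewrite fctE expf_neq0.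
have -> : cot_der m = cot_num m * (fun y => ((sin ^+ m) y)^-1).
  by apply/funext => y; rewrite /cot_der !fctE.
apply: (is_derive_eq (is_deriveM numd (is_deriveV sxm (is_deriveX m (is_derive_sin x))))).
rewrite /cot_der cot_numS //.
rewrite [X in _ = - (X / _)](eq_bigr (fun l : 'I_m.+1 => ((circular_eulerian m l)%:R *
   ((2 * l%:R - m%:R) * sin ((2 * l%:R - m%:R) * x))) * sin x
   + ((circular_eulerian m l)%:R * cos ((2 * l%:R - m%:R) * x)) * (m%:R * cos x))).
  rewrite big_split /= -!mulr_suml -/(cot_num m x).
  move: (\sum_(i < m.+1) _) (cot_num m x) => u v.
  rewrite !fctE /GRing.scale /=.
  case: m m0 {numd sxm} => // m _; rewrite /= !exprS expr0.
  by field; rewrite sx expf_neq0.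
by move=> l _; ring.
Qed.

Lemma cot_der1 x : cot_der 1 x = cos x / sin x.
Proof.
rewrite /cot_der /cot_num big_ord_recl big_ord1 !circular_eulerian1 /= mulr0 !mul0r.
by rewrite sub0r mulN1r cosN mul1r addr0 expr1.
Qed.

Lemma near_sin_neq0 x : sin x != 0 -> \forall y \near x, sin y != 0.
Proof.
by move=> sx; have := @continuous_sin R x; move/cvgr_neq0; apply.
Qed.

Lemma sin_half x : sin x = 2 * sin (x / 2) * cos (x / 2).
Proof. by rewrite {1}[x]splitr -mulr2n sin_mulr2n -mulr_natl; ring. Qed.

Lemma sin_half_sub_pi x : sin ((x - pi) / 2) = - cos (x / 2).
Proof. by rewrite mulrBl sinBpihalf. Qed.

Lemma sin_half_neq0 x : sin x != 0 ->
  (sin (x / 2) != 0) /\ (sin ((x - pi) / 2) != 0).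
Proof.
rewrite sin_half sin_half_sub_pi oppr_eq0 !mulf_eq0 !negb_or.
by case/andP=> /andP[].
Qed.

(** Induction on [m]: the cotangent itself obeys its double angle formula, and each differentiation
    contributes a factor 1/2 by the chain rule. *)
Lemma cot_der_duplication m x : (0 < m)%N -> sin x != 0 ->
  cot_der m x = 2 ^- m * (cot_der m (x / 2) + cot_der m ((x - pi) / 2)).
Proof.
case: m => // m _; elim: m x => [|m IHm] x sx.
  have [sx1 sx2] := sin_half_neq0 sx.
  rewrite !cot_der1 expr1 sin_half_sub_pi (mulrBl _ x pi) cosBpihalf.
  move: sx2; rewrite sin_half_sub_pi oppr_eq0 => cx.
  rewrite {1}[x]splitr -[X in cos X]mulr2n cos_mulr2n sin_half.
  have e : (cos (x / 2)) ^+ 2 *+ 2 - 1 = (cos (x / 2)) ^+ 2 - (sin (x / 2)) ^+ 2.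
    by rewrite sin2cos2; ring.
  by rewrite e; field; rewrite cx sx1.
have [sx1 sx2] := sin_half_neq0 sx.
pose f y := 2 ^- m.+1 * (cot_der m.+1 (y / 2) + cot_der m.+1 ((y - pi) / 2)).
have fd : is_derive x 1 f (- (2 ^- m.+2 * (cot_der m.+2 (x / 2) + cot_der m.+2 ((x - pi) / 2)))).
  have -> : f = 2 ^- m.+1 \*: ((fun y => cot_der m.+1 (2^-1 * y + 0))
      + (fun y => cot_der m.+1 (2^-1 * y + (- pi / 2)))).
    by apply/funext => y; rewrite !fctE /f; congr (_ * (cot_der _ _ + cot_der _ _)); field.
  have e1 : 2^-1 * x + 0 = x / 2 by field.
  have e2 : 2^-1 * x + (- pi / 2) = (x - pi) / 2 by field.
  rewrite -e1 in sx1; rewrite -e2 in sx2.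
  have d1 := is_derive_affine (is_derive_cot_der (ltn0Sn m) sx1).
  have d2 := is_derive_affine (is_derive_cot_der (ltn0Sn m) sx2).
  apply: (is_derive_eq (is_deriveZ _ (is_deriveD d1 d2))).
  rewrite e1 e2 /GRing.scale /= [_ ^+ m.+2]exprS; field; rewrite expf_neq0 // pnatr_eq0.
(* Comparing derivatives needs the induction hypothesis on a neighbourhood; it is available there
   because [sin] stays nonzero near [x]. *)
have fE : \forall y \near x, f y = cot_der m.+1 y.
  by apply: filterS (near_sin_neq0 sx) => y sy; rewrite /f -IHm.
have [_ /eqP] := near_eq_is_derive fE fd.
have [_ ->] := is_derive_cot_der (ltn0Sn m) sx.
by rewrite eqr_opp => /eqP.
Qed.


(** * Even powers of the cosecant *)

(* t(k, i) in a form that is also correct at k < i, where it vanishes, and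
   that has the value 1 instead of 1/2 at k = i = 0. *)
Definition cheb_coef (k i : nat) : R :=
  (-1) ^+ (k + i) * 4 ^+ i / 2 * ('C(k + i, 2 * i) + 'C((k + i).-1, 2 * i))%:R.

(** Since (k+i) C(k+i-1,2i) = (k-i) C(k+i,2i), the two binomials of [cheb_coef] add up to 2k/(k+i)
    C(k+i,2i). *)
Lemma t_coefE k i : (0 < k)%N -> (i <= k)%N -> t_coef R k i = cheb_coef k i.
Proof.
move=> k0 ik; rewrite /t_coef gtn_eqF // /cheb_coef !natrD exprM (_ : 2 ^+ 2 = 4);
  last by rewrite -natrX.
have -> : (-1) ^+ (k + i) = (-1) ^+ (k - i) :> R.
  by rewrite -[LHS]signr_odd -[RHS]signr_odd oddD oddB.
have -> : 'C(k + i, k - i) = 'C(k + i, 2 * i).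
  by rewrite -bin_sub; [congr 'C(_, _); lia | lia].
have e : ((k + i) * 'C((k + i).-1, 2 * i) = (k - i) * 'C(k + i, 2 * i))%N.
  by rewrite mul_bin_down; congr (_ * _)%N; lia.
have ki : k%:R + i%:R != 0 :> R by rewrite -natrD pnatr_eq0 -lt0n ltn_addr.
have {e} := congr1 (fun n => n%:R : R) e; rewrite !natrM natrB // natrD => e.
have -> : 'C((k + i).-1, 2 * i)%:R =
   (k%:R - i%:R) * 'C(k + i, 2 * i)%:R / (k%:R + i%:R) :> R.
  by rewrite -e; field.
by field.
Qed.

Lemma cheb_coef_gt k i : (k < i)%N -> cheb_coef k i = 0.
Proof. by move=> ki; rewrite /cheb_coef !bin_small ?mulr0 //; lia. Qed.

(** Pascal's rule gives the coefficient form of the three-term recurrence for (-1)^k cos(2kx), with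
    cos(2x) = 1 - 2 sin(x)^2. *)
Lemma cheb_coefSS k i : cheb_coef k.+2 i.+1 =
  4 * cheb_coef k.+1 i - 2 * cheb_coef k.+1 i.+1 - cheb_coef k i.+1.
Proof.
rewrite /cheb_coef mulnS add2n !addSn !addnS /= !binS !natrD !exprS.
by field.
Qed.

Lemma cheb_coefS0 k : cheb_coef k.+2 0 = - 2 * cheb_coef k.+1 0 - cheb_coef k 0.
Proof. by rewrite /cheb_coef !addn0 muln0 !bin0 !exprS; field. Qed.

(** The right-hand side is the Chebyshev polynomial of degree 2k at sin x. The bound [M] is free so
    that different [k] can share one range. *)
Lemma cos_cheb k M x : (k <= M)%N ->
  (-1) ^+ k * cos (2 * k%:R * x) =
  \sum_(i < M.+1) cheb_coef k i * sin x ^+ (2 * i).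
Proof.
elim/ltn_ind: k => -[|[|k]] IHk kM.
- rewrite big_ord_recl big1 => [|i _]; last by rewrite cheb_coef_gt ?mul0r.
  by rewrite /cheb_coef !mulr0 mul0r cos0 !expr0 /= addn0 muln0 bin0; field.
- case: M kM IHk => // M _ _.
  rewrite big_ord_recl big_ord_recl big1 => [|i _].
    rewrite addr0 /= (_ : bump 0 0 = 1%N) // (_ : cheb_coef 1 0 = -1);
      last by rewrite /cheb_coef addn0 muln0 !bin0; field.
    rewrite (_ : cheb_coef 1 1 = 2); last by rewrite /cheb_coef addn1 muln1 binn bin_small //;
      field.
    by rewrite mulr1 mulr_natl cos_mulr2n cos2sin2; ring.
  by rewrite cheb_coef_gt ?mul0r.
have cosS : cos (2 * k.+2%:R * x) =
  2 * (1 - 2 * sin x ^+ 2) * cos (2 * k.+1%:R * x) - cos (2 * k%:R * x).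
  have -> : 1 - 2 * sin x ^+ 2 = cos (x *+ 2).
    by rewrite cos_mulr2n cos2sin2; ring.
  have -> : 2 * k.+2%:R * x = 2 * k.+1%:R * x + x *+ 2 by rewrite -[k.+2%:R]natr1; ring.
  have -> : 2 * k%:R * x = 2 * k.+1%:R * x - x *+ 2 by rewrite -natr1; ring.
  by rewrite cosD cosB; ring.
have := IHk k.+1 (ltnSn _) (ltnW kM).
have := IHk k (leqnSn _) (ltnW (ltnW kM)).
set S0 := \sum_(i < _) _ => e0; set S1 := \sum_(i < _) _ => e1.
transitivity (4 * sin x ^+ 2 * S1 - 2 * S1 - S0).
  by rewrite cosS -e0 -e1 !exprS; ring.
rewrite big_ord_recl cheb_coefS0 muln0 expr0 mulr1.
rewrite (eq_bigr (fun i : 'I_M => 4 * (cheb_coef k.+1 i * sin x ^+ (2 * i.+1))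
   - 2 * (cheb_coef k.+1 i.+1 * sin x ^+ (2 * i.+1))
   - cheb_coef k i.+1 * sin x ^+ (2 * i.+1))); last first.
  by move=> i _; rewrite /= /bump add1n cheb_coefSS; ring.
rewrite !sumrB -!mulr_sumr.
have -> : S0 = cheb_coef k 0 + \sum_(i < M) cheb_coef k i.+1 * sin x ^+ (2 * i.+1).
  by rewrite /S0 big_ord_recl muln0 expr0 mulr1.
have e : sin x ^+ 2 * S1 = \sum_(i < M) cheb_coef k.+1 i * sin x ^+ (2 * i.+1).
  rewrite /S1 big_ord_recr /= cheb_coef_gt // mul0r addr0 mulr_sumr.
  by apply: eq_bigr => i _; rewrite mulnS exprD mulrCA.
rewrite -e mulrA; have {2}-> : S1 = cheb_coef k.+1 0
    + \sum_(i < M) cheb_coef k.+1 i.+1 * sin x ^+ (2 * i.+1).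
  by rewrite /S1 big_ord_recl muln0 expr0 mulr1.
by ring.
Qed.

(** Vanishing coefficients extend the sum over [l] from [i] to [n], making its range independent of
    [i]. The factor at [l == n] restores t(0,0) = 1/2, since [cheb_coef 0 0] is 1. *)
Lemma a_coefE n i : (1 <= i <= n)%N ->
  a_coef R n i = 2 * \sum_(1 <= l < n.+1) (-1) ^+ (n - l) * cheb_coef (n - l) (n - i)
    * (if l == n then 2^-1 else 1) * (circular_eulerian (2 * n) l)%:R.
Proof.
move=> /andP[i1 lein]; rewrite /a_coef; congr (2 * _).
rewrite [RHS](big_cat_nat (n := i.+1)) //= [X in _ = _ + X]big_nat_cond [X in _ = _ + X]big1 ?addr0.
  apply: eq_big_nat => l /andP[l1 li]; congr (_ * _); rewrite -mulrA; congr (_ * _).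
  case: (ltngtP l n) => [ln|ln|ln].
  - by rewrite t_coefE ?mulr1 ?subn_gt0 ?leq_sub2l.
  - by move: ln; rewrite ltnNge (leq_trans _ lein).
  - have -> : i = n by lia.
    by rewrite ln subnn /t_coef /cheb_coef eqxx addn0 muln0 bin0; field.
move=> l /andP[/andP[il ln] _]; rewrite cheb_coef_gt ?mulr0 ?mul0r //; lia.
Qed.

Lemma cot_der_csc n x : (0 < n)%N -> sin x != 0 ->
  \sum_(1 <= i < n.+1) a_coef R n i / sin x ^+ (2 * i) = cot_der (2 * n) x.
Proof.
move=> n0 sx; rewrite /cot_der /cot_num.
have en k : (2 * n <= k)%N -> circular_eulerian (2 * n) k = 0%N.
  by apply: circular_eulerian_ge; rewrite muln_gt0.
have e0 : circular_eulerian (2 * n) 0 = 0%N.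
  by case: n n0 {sx en} => // n _; rewrite mulnS circular_eulerian_n0.
have esym k : (k <= 2 * n)%N ->
    circular_eulerian (2 * n) (2 * n - k) = circular_eulerian (2 * n) k.
  by case: n n0 {sx en e0} => // n _; rewrite mulnS; exact: circular_eulerian_sym.
set e := circular_eulerian (2 * n) in en e0 esym *.
have cosE l : (l <= n)%N -> cos ((2 * l%:R - (2 * n)%:R) * x) = cos (2 * (n - l)%:R * x).
  by move=> ln; rewrite -[RHS]cosN natrB // natrM; congr cos; ring.
have symE : \sum_(l < (2 * n).+1) (e l)%:R * cos ((2 * l%:R - (2 * n)%:R) * x)
   = 2 * \sum_(1 <= l < n.+1) (if l == n then 2^-1 else 1) * (e l)%:R
        * cos (2 * (n - l)%:R * x).
  (* The upper half, shifted and reversed, repeats the lower half by symmetry. The middle term l = n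
     is single, whence its weight 1/2, and l = 0 drops out as A(2n,0) = 0. *)
  rewrite -(big_mkord predT (fun l => (e l)%:R * cos ((2 * l%:R - (2 * n)%:R) * x))).
  rewrite (big_cat_nat (n := n)) //=; last by lia.
  rewrite big_nat_recl; last by lia.
  rewrite -[X in index_iota X (2 * n)]add0n big_addn (_ : 2 * n - n = n)%N; last by lia.
  rewrite [X in _ + (_ + X)]big_nat_rev /= add0n.
  rewrite [X in _ + (_ + X)](eq_big_nat _ _
    (F2 := fun i => (e i)%:R * cos (2 * (n - i)%:R * x))); last first.
    move=> i /andP[_ lin]; rewrite (_ : (n - i.+1 + n).+1 = 2 * n - i)%N; last by lia.
    rewrite esym; last by lia.
    by congr (_ * cos _); rewrite !natrB ?natrM; [ring|lia|lia].
  rewrite [X in X + _ = _](eq_big_nat _ _ (F2 := fun i => (e i)%:R * cos (2 * (n - i)%:R * x)));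
    last first.
    by move=> i /andP[_ lin]; rewrite cosE // ltnW.
  rewrite big_ltn // e0 mul0r add0r cosE // [in RHS]big_nat_recr //= eqxx.
  rewrite [X in _ = 2 * (X + _)](eq_big_nat _ _
    (F2 := fun i => (e i)%:R * cos (2 * (n - i)%:R * x))); last first.
    by move=> i /andP[_ lin]; rewrite ltn_eqF // mul1r.
  rewrite subnn mulr0 mul0r cos0.
  by field.
rewrite symE mulrAC mulr_sumr.
transitivity (\sum_(1 <= i < n.+1) \sum_(1 <= l < n.+1) 2 / sin x ^+ (2 * i) *
   ((-1) ^+ (n - l) * cheb_coef (n - l) (n - i)
    * (if l == n then 2^-1 else 1) * (e l)%:R)).
  apply: eq_big_nat => i lin; rewrite a_coefE // mulrAC -mulr_sumr.
  by [].
rewrite exchange_big_nat /=; apply: eq_big_nat => l /andP[l0 ln].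
case: n n0 {symE cosE en e0 esym} @e ln => // n _ e ln.
(* Since [l] is at least 1, the degree in sin(x)^2 is at most [n], below the power [n.+1] in the
   denominator, so no constant term arises. *)
have -> : cos (2 * (n.+1 - l)%:R * x) =
    (-1) ^+ (n.+1 - l) * \sum_(i < n.+1) cheb_coef (n.+1 - l) i * sin x ^+ (2 * i).
  rewrite -cos_cheb; last by lia.
  by rewrite mulrA -exprMn mulrNN mulr1 expr1n mul1r.
rewrite -(big_mkord predT (fun i => cheb_coef (n.+1 - l) i * sin x ^+ (2 * i))) !mulr_sumr.
rewrite [RHS]big_nat_rev /= add0n big_add1; apply: eq_big_nat => i /andP[_ lin].
rewrite subSS (_ : sin x ^+ (2 * n.+1) = sin x ^+ (2 * (n - i)) * sin x ^+ (2 * i.+1)); last first.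
  by rewrite -exprD; congr (_ ^+ _); lia.
by field; rewrite !expf_neq0.
Qed.
End CotangentDerivatives.

(** * Bounds and the pole at 0 of the cotangent derivatives *)

Section CotangentEstimates.
Local Open Scope classical_set_scope.
Local Open Scope ring_scope.
Variable R : realType.
Implicit Types x y : R.

Lemma cot_num_le m x : `|cot_num m.+1 x| <= m`!%:R.
Proof.
rewrite -sum_circular_eulerian natr_sum /cot_num.
apply: le_trans (ler_norm_sum _ _ _) _; apply: ler_sum => l _.
by rewrite normrM normr_nat ler_piMr ?ler0n ?cos_max.
Qed.

(** Up to 1 the mean value theorem gives sin y >= cos(1) y. Beyond 1, sin y >= sin 1 >= cos 1 while
    y < 2, which costs the factor 2. *)
Lemma le_sin y : 0 <= y <= pi / 2 -> cos 1 * y <= 2 * sin y.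
Proof.
move=> /andP[]; rewrite le_eqVlt => /predU1P[<-|y0 yp].
  by rewrite sin0 !mulr0.
have pi2 : pi / 2 < 2 :> R by exact: pihalf_lt2.
have c1 : 0 < cos 1 :> R by exact: cos1_gt0.
have small (z : R) : 0 < z <= 1 -> cos 1 * z <= sin z.
  case/andP=> z0 z1; have ds c : c \in `]0, z[ -> is_derive c 1 (@sin R) (cos c).
    by move=> _; exact: is_derive_sin.
  have /(MVT z0 ds)[c cz] : {within `[0, z], continuous (@sin R)}%classic.
    by apply: continuous_subspaceT => c; exact: continuous_sin.
  rewrite sin0 !subr0 => ->; rewrite ler_pM2r //.
  move: cz; rewrite in_itv /= => /andP[c0 cz].
  have p1 : 1 <= pi :> R by rewrite (le_trans _ (pi_ge2 R)) // ler1n.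
  by rewrite ltW // ltr_cos ?in_itv /=; lra.
case: (lerP y 1) => y1.
  have sy := small y; rewrite y0 y1 in sy.
  have := sy isT; have : 0 <= cos 1 * y by rewrite mulr_ge0 // ltW.
  lra.
have /small : 0 < (1 : R) <= 1 by rewrite ltr01 lexx.
rewrite mulr1 => s1.
have : sin 1 <= sin y :> R.
  rewrite ltW // ltr_sin // in_itv /=; lra.
nra.
Qed.

(** The bound is uniform in [y] and serves as majorant for dominated convergence. *)
Lemma cot_der_le m y : 0 < y <= pi / 2 ->
  `|y ^+ m.+1 * cot_der m.+1 y| <= (2 / cos 1) ^+ m.+1 * m`!%:R.
Proof.
case/andP=> y0 yp; have c1 : 0 < cos 1 :> R by exact: cos1_gt0.
have sy := @le_sin y; rewrite (ltW y0) yp in sy.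
have sy0 : 0 < sin y by have := sy isT; nra.
rewrite /cot_der mulrCA normrM mulrC -expr_div_n ler_pM //; last exact: cot_num_le.
have q0 : 0 <= y / sin y by rewrite divr_ge0 // ltW.
have r0 : 0 <= 2 / cos 1 :> R by rewrite divr_ge0 // ltW.
rewrite normrX (ger0_norm q0) lerXn2r ?nnegrE //.
by rewrite ler_pdivrMr // mulrAC ler_pdivlMr // mulrC sy.
Qed.

Lemma cvg_sin_div : (sin x / x @[x --> (0 : R)^'] --> (1 : R)).
Proof.
have ds (x : R) : is_derive x 1 (@sin R) (cos x) := is_derive_sin x.
have di (x : R) : is_derive x 1 (@id R) 1 := is_derive_id x 1.
have -> : (1 : R) = cos 0 / 1 by rewrite cos0 divr1.
have c0 : 0 \in `](-1), (1 : R)[ by rewrite in_itv /= ltr01 ltrN10.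
apply: (lhopital c0 (fun x _ => ds x) (fun x _ => di x)).
- by rewrite -[X in (_ --> X)](@sin0 R); exact: continuous_sin.
- exact: cvg_id.
- by move=> x _; exact: oner_neq0.
- rewrite cos0 divr1 -[X in (_ --> X)](@cos0 R).
  by under eq_fun do rewrite divr1; exact: continuous_cos.
Qed.

Lemma dnbhs0_sin_neq0 : \forall x \near (0 : R)^', sin x != 0.
Proof.
near=> x.
have : sin x / x != 0.
  by near: x; move/cvgr_neq0: cvg_sin_div; apply; exact: oner_neq0.
by rewrite mulf_eq0 negb_or => /andP[].
Unshelve. all: by end_near. Qed.

Lemma continuous_is_derive (f : R -> R) x df : is_derive x 1 f df -> {for x, continuous f}.
Proof. by case=> fx _; apply/differentiable_continuous/derivable1_diffP. Qed.

Lemma cot_der_cvg m :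
  (y ^+ m.+1 * cot_der m.+1 y @[y --> (0 : R)^'] --> (m`!%:R : R)).
Proof.
have -> : (fun y => y ^+ m.+1 * cot_der m.+1 y) =
    (fun y => (sin y / y)^-1 ^+ m.+1) \* cot_num m.+1.
  by apply/funext => y; rewrite /cot_der /= invf_div expr_div_n mulrCA mulrC.
rewrite -[X in (_ --> X)]mul1r; apply: cvgM.
  rewrite -[X in (_ --> X)](expr1n _ m.+1).
  apply: (@continuous_cvg _ _ _ _ _ (fun y => (sin y / y)^-1) (fun z => z ^+ m.+1)).
    exact: exprn_continuous.
  by rewrite -[X in (_ --> X)]invr1; apply: cvgV; [exact: oner_neq0|exact: cvg_sin_div].
have <- : cot_num m.+1 0 = m`!%:R :> R.
  rewrite -sum_circular_eulerian natr_sum; apply: eq_bigr => l _.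
  by rewrite mulr0 cos0 mulr1.
by apply/continuous_withinNx; apply: continuous_is_derive (is_derive_cot_num _ _).
Qed.

(* The difference h satisfies h(x) = 2^-(m+1) (h(x/2) + g(x)) with g bounded
   near 0, and 2^-(m+1)r h(x / 2^r) tends to 0. *)
Lemma cot_der_pole m : exists C,
  \forall x \near (0 : R)^', `|cot_der m.+1 x - m`!%:R / x ^+ m.+1| <= C.
Proof.
pose g x := cot_der m.+1 ((x - pi) / 2).
(* At 0 the argument of [cot_der] is -pi/2, where the sine is -1, so [g] has no pole there. *)
have gcont : {for 0, continuous g}.
  have -> : g = (fun x => cot_der m.+1 (2^-1 * x + (- pi / 2))).
    by apply/funext => x; rewrite /g; congr cot_der; field.
  apply: continuous_is_derive; apply: is_derive_affine.
  apply: is_derive_cot_der => //.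
  by rewrite mulr0 add0r mulNr sinN sin_pihalf oppr_eq0 oner_neq0.
have [C gC] : exists C : R, \forall x \near 0, `|g x| <= C.
  exists (`|g 0| + 1).
  by move/cvgr_norm_le: (gcont); apply; rewrite ltrDl ltr01.
have sin0' := dnbhs0_sin_neq0.
have [d /= d0 dP] : exists2 d : R, 0 < d & forall x, 0 < `|x| < d -> `|g x| <= C /\ sin x != 0.
  have [d /= d0 dP] : \forall x \near (0 : R)^', `|g x| <= C /\ sin x != 0.
    by near=> x; split; near: x; [apply: cvg_within|].
  exists d => // x /andP[x0 xd]; apply: dP; first by rewrite /= sub0r normrN.
  by rewrite -normr_gt0.
pose h x := cot_der m.+1 x - m`!%:R / x ^+ m.+1.
(* The constant 2C survives each halving, since (2C + C) / 2 <= 2C. *)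
have step x r : 0 < `|x| < d -> `|h x| <= `|2 ^- m.+1 ^+ r * h (x / 2 ^+ r)| + 2 * C.
  move=> xd; have C0 : 0 <= C by apply: le_trans (dP x xd).1.
  elim: r x xd => [|r IHr] x xd.
    by rewrite !expr0 mul1r divr1 lerDl mulr_ge0.
  have [gx sx] := dP x xd; case/andP: xd => x0 xd.
  (* The pole terms at x and x/2 cancel, as 2^(-m-1) (x/2)^(-m-1) = x^(-m-1). *)
  have hx : h x = 2 ^- m.+1 * (h (x / 2) + g x).
    rewrite /h cot_der_duplication // /g expr_div_n invf_div.
    have x1 : x != 0 by rewrite -normr_gt0.
    by field; rewrite !expf_neq0 // pnatr_eq0.
  have xd2 : 0 < `|x / 2| < d.
    by rewrite normrM normfV normr_nat; apply/andP; split; lra.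
  have := IHr _ xd2.
  rewrite -mulrA -invfM -exprS hx => hx2.
  rewrite [_ ^+ r.+1]exprS -mulrA !normrM.
  set A := `|2 ^- m.+1|; set B := `|h (x / 2 ^+ r.+1)| in hx2 *.
  rewrite normrM -/B in hx2.
  have A0 : 0 <= A by exact: normr_ge0.
  have A1 : A <= 1 / 2.
    rewrite /A normfV normrX normr_nat exprS invfM ler_pdivrMr //.
    have pm : 1 <= 2 ^+ m :> R by rewrite exprn_ege1 // ler1n.
    lra.
  have := ler_normD (h (x / 2)) (g x).
  set P := `|2 ^- m.+1 ^+ r| * B in hx2 *; set S := `|_ + _| => hS.
  have : A * S <= A * (P + 3 * C) by rewrite ler_wpM2l //; lra.
  have : A * C <= 1 / 2 * C by rewrite ler_wpM2r.
  lra.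
exists (1 + 2 * C); near=> x.
have xd : 0 < `|x| < d.
  apply/andP; split; first by rewrite normr_gt0; near: x; exact: nbhs_dnbhs_neq.
  by near: x; apply: dnbhs0_lt.
have [/andP[x0 _] x0'] : 0 < `|x| < d /\ x != 0.
  by split=> //; rewrite -normr_gt0; case/andP: xd.
have xm0 : 0 < `|x| ^+ m.+1 by rewrite exprn_gt0.
(* The tolerance |x|^(m+1) leaves an error of at most 1 after division by x^(m+1); [r] then brings x
   / 2^r within the radius [e]. *)
have /cvgrPdist_le/(_ _ xm0)[e /= e0 eP] := @cot_der_cvg m.
pose r := Num.bound (`|x| / e).
have re : `|x / 2 ^+ r| < e.
  rewrite normrM normfV normrX normr_nat ltr_pdivrMr ?exprn_gt0 // mulrC -ltr_pdivrMr //.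
  apply: lt_trans (archi_boundP _) _; first by rewrite divr_ge0 // ltW.
  by rewrite -natrX ltr_nat ltn_expl.
have xr0 : x / 2 ^+ r != 0 by rewrite mulf_neq0 // invr_neq0 // expf_neq0 // pnatr_eq0.
apply: le_trans (step x r xd) _; rewrite lerD2r.
have := eP (x / 2 ^+ r); rewrite /= sub0r normrN => /(_ re xr0).
rewrite distrC; set p := cot_der _ _ => hp.
have -> : 2 ^- m.+1 ^+ r * h (x / 2 ^+ r) =
    x ^- m.+1 * ((x / 2 ^+ r) ^+ m.+1 * p - m`!%:R).
  rewrite /h -/p !expr_div_n !exprVn -!exprM [(r * _)%N]mulnC.
  by field; rewrite !expf_neq0 // pnatr_eq0.
by rewrite normrM normfV normrX mulrC ler_pdivrMr // mul1r.
Unshelve. all: by end_near. Qed.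

End CotangentEstimates.

(** * Power series and Laurent expansions *)

Section PowerSeries.
Local Open Scope classical_set_scope.
Local Open Scope ring_scope.
Variable R : realType.
Implicit Types (p q : nat -> R) (f g : R -> R) (x : R).

Definition cauchy_prod p q (k : nat) : R := \sum_(i < k.+1) p i * q (k - i)%N.

Lemma seriesE (u : nat -> R) m : series u m = \sum_(i < m) u i.
Proof. by rewrite /series /= big_mkord. Qed.

Lemma series_cauchy_prod p q m :
  series (cauchy_prod p q) m = \sum_(i < m) p i * series q (m - i)%N.
Proof.
rewrite seriesE; elim: m => [|m IHm]; first by rewrite !big_ord0.
rewrite big_ord_recr IHm [RHS]big_ord_recr /= subSnn seriesE big_ord1 /cauchy_prod.
rewrite [in LHS]big_ord_recr /= subnn addrA; congr (_ + _).
rewrite -big_split; apply: eq_bigr => i _ /=.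
by rewrite subSn 1?ltnW // !seriesE big_ord_recr /= mulrDr.
Qed.

(** The product of the partial sums and the partial sum of the Cauchy product differ by at most K^2
    m^2 8^(-m), which is at most K^2 2^(-m) because m <= 2^m. *)
Lemma cvg_series_cauchy_prod p q (K a b : R) :
  (forall k, `|p k| <= K * 8^-1 ^+ k) -> (forall k, `|q k| <= K * 8^-1 ^+ k) ->
  series p @ \oo --> a -> series q @ \oo --> b ->
  series (cauchy_prod p q) @ \oo --> a * b.
Proof.
move=> pK qK pa qb.
have K0 : 0 <= K by have := pK 0%N; rewrite expr0 mulr1; apply: le_trans.
have -> : series (cauchy_prod p q) = (series p \* series q) \-
  (fun m => series p m * series q m - series (cauchy_prod p q) m).
  by apply/funext => m /=; rewrite opprB addrC subrK.
rewrite -[X in _ --> X]subr0; apply: cvgB; first exact: cvgM.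
apply/norm_cvg0P; apply: (@squeeze_cvgr _ _ _ _ (fun _ => 0) (fun m => K ^+ 2 * 2^-1 ^+ m)).
- near=> m; rewrite normr_ge0 /=.
  rewrite series_cauchy_prod [series p m]seriesE mulr_suml -sumrB.
  apply: le_trans (ler_norm_sum _ _ _) _.
  have tail i : (i <= m)%N -> `|series q m - series q (m - i)%N| <= K * i%:R * 8^-1 ^+ (m - i).
    move=> im; rewrite !seriesE -!(big_mkord predT) (big_cat_nat (n := (m - i)%N)) ?leq_subr //=.
    rewrite addrAC subrr add0r; apply: le_trans (ler_norm_sum _ _ _) _.
    apply: le_trans (ler_sum_nat (G := fun=> K * 8^-1 ^+ (m - i)) _) _.
      move=> j /andP[jm _]; apply: le_trans (qK j) _; rewrite ler_wpM2l //.
      by rewrite ler_wiXn2l //; lra.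
    by rewrite sumr_const_nat subKn // -[_ *+ i]mulr_natr mulrAC lexx.
  apply: (@le_trans _ _ (\sum_(i < m) K ^+ 2 * m%:R * 8^-1 ^+ m)).
    apply: ler_sum => i _; rewrite -mulrBr normrM.
    have im := ltnW (ltn_ord i).
    apply: (@le_trans _ _ ((K * 8^-1 ^+ i) * (K * i%:R * 8^-1 ^+ (m - i)))).
      by apply: ler_pM => //; exact: tail.
    rewrite (_ : _ * _ = K ^+ 2 * i%:R * 8^-1 ^+ m).
      by rewrite ler_wpM2r ?exprn_ge0 // ler_wpM2l ?exprn_ge0 // ler_nat.
    by rewrite -[in _ ^+ m](subnKC im) exprD; ring.
  rewrite sumr_const card_ord -[_ *+ m]mulr_natr.
  have -> : K ^+ 2 * m%:R * 8^-1 ^+ m * m%:R = K ^+ 2 * ((m%:R * 2^-1 ^+ m) ^+ 2 * 2^-1 ^+ m).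
    rewrite (_ : 8^-1 = 2^-1 ^+ 3 :> R) -?exprM; last by field.
    by rewrite mulnC exprM; ring.
  rewrite ler_wpM2l ?exprn_ge0 // ler_piMl ?exprn_ge0 // expr_le1 ?mulr_ge0 ?exprn_ge0 //.
  by rewrite exprVn ler_pdivrMr ?exprn_gt0 // mul1r -natrX ler_nat ltnW // ltn_expl.
- exact: cvg_cst.
- rewrite -[X in _ --> X](mulr0 (K ^+ 2)); apply: cvgM; first exact: cvg_cst.
  by apply: cvg_expr; rewrite ger0_norm; lra.
Unshelve. all: by end_near. Qed.

(** The exponent [k.+1] lets one constant serve as ratio and as leading factor. *)
Definition geometric_bound p := exists2 C : R, 1 <= C & forall k, `|p k| <= C ^+ k.+1.

(** The sum is prescribed off 0 only, since sin x / x takes the default value 0 at 0. *)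
Definition punctured_pser p f := geometric_bound p /\
  \forall x \near (0 : R)^', series (fun k => p k * x ^+ k) @ \oo --> f x.

(** For |x| < 1/(8C) the terms decay with the ratio 1/8 required by [cvg_series_cauchy_prod]. *)
Lemma geometric_bound_near p : geometric_bound p -> exists2 C : R, 0 <= C &
  \forall x \near (0 : R)^', forall k, `|p k * x ^+ k| <= C * 8^-1 ^+ k.
Proof.
case=> C C1 pC; have C0 : 0 < C by lra.
exists C; first exact: ltW.
have e0 : 0 < 8^-1 / C by rewrite divr_gt0 // invr_gt0.
near=> x => k.
have xC : `|x| < 8^-1 / C by near: x; exact: dnbhs0_lt.
rewrite normrM normrX; apply: (@le_trans _ _ (C ^+ k.+1 * (8^-1 / C) ^+ k)).
  by apply: ler_pM; rewrite ?exprn_ge0 // lerXn2r ?nnegrE // ltW.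
by rewrite expr_div_n exprS mulrA mulrAC mulfK // expf_neq0 // gt_eqF.
Unshelve. all: by end_near. Qed.

Lemma cvg_series_geometric (u : nat -> R) C :
  (forall k, `|u k| <= C * 8^-1 ^+ k) -> cvgn (series u).
Proof.
move=> uC; apply: normed_cvg; apply: (@series_le_cvg _ _ (geometric C 8^-1)) => //.
- by move=> k /=; exact: normr_ge0.
- by move=> k; exact: le_trans (normr_ge0 _) (uC k).
- by apply: is_cvg_geometric_series; rewrite ger0_norm; lra.
Qed.

Lemma punctured_pser_mul p q f g : punctured_pser p f -> punctured_pser q g ->
  punctured_pser (cauchy_prod p q) (fun x => f x * g x).
Proof.
move=> [pb pf] [qb qg]; split.
  case: pb qb => C C1 pC [D D1 qD].
  pose M := C * D; have M1 : 1 <= M by rewrite /M -[1]mulr1 ler_pM.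
  (* The k+1 summands are at most M^(k+2) each, and k+1 <= 2^(k+1), k+2 <= 2(k+1). *)
  exists (2 * M ^+ 2); first by have := exprn_ege1 2 M1; lra.
  move=> k; apply: le_trans (ler_norm_sum _ _ _) _.
  apply: (@le_trans _ _ (\sum_(i < k.+1) M ^+ k.+2)).
    apply: ler_sum => i _; rewrite normrM.
    apply: (@le_trans _ _ (M ^+ i.+1 * M ^+ (k - i).+1)).
      apply: ler_pM => //.
        apply: le_trans (pC i) _; rewrite lerXn2r ?nnegrE ?mulr_ge0 //; try lra.
        by rewrite /M ler_peMr //; lra.
      apply: le_trans (qD _) _; rewrite lerXn2r ?nnegrE ?mulr_ge0 //; try lra.
      by rewrite /M ler_peMl //; lra.
    rewrite -exprD (_ : (i.+1 + (k - i).+1 = k.+2)%N) //.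
    by have := ltn_ord i; lia.
  rewrite sumr_const card_ord -[_ *+ k.+1]mulr_natl [(2 * _) ^+ _]exprMn -exprM.
  apply: ler_pM; rewrite ?exprn_ge0 ?ler0n //; first by lra.
    by rewrite -natrX ler_nat ltnW // ltn_expl.
  by rewrite ler_weXn2l //; lia.
have [C C0 pC] := geometric_bound_near pb.
have [D D0 qD] := geometric_bound_near qb.
near=> x.
have -> : (fun k => cauchy_prod p q k * x ^+ k) =
    cauchy_prod (fun k => p k * x ^+ k) (fun k => q k * x ^+ k).
  apply/funext => k; rewrite /cauchy_prod mulr_suml; apply: eq_bigr => i _.
  by rewrite -[X in x ^+ X](subnKC (_ : i <= k)%N) ?exprD -1?ltnS //; ring.
have CD0 k : 0 <= (8^-1 : R) ^+ k by rewrite exprn_ge0.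
have px k : `|p k * x ^+ k| <= C * 8^-1 ^+ k by move: k; near: x; exact: pC.
have qx k : `|q k * x ^+ k| <= D * 8^-1 ^+ k by move: k; near: x; exact: qD.
apply: (@cvg_series_cauchy_prod _ _ (C + D)).
- by move=> k; have := mulr_ge0 D0 (CD0 k); have := px k; rewrite mulrDl; lra.
- by move=> k; have := mulr_ge0 C0 (CD0 k); have := qx k; rewrite mulrDl; lra.
- by near: x.
- by near: x.
Unshelve. all: by end_near. Qed.

Lemma punctured_pser1 : punctured_pser (fun k => (k == 0%N)%:R) (fun=> 1).
Proof.
split.
  exists 1 => // k; rewrite expr1n; by case: k => [|k]; rewrite /= ?normr1 ?normr0.
near=> x; rewrite -(cvg_shiftn 1).
rewrite (_ : (fun n => _) = cst 1); first exact: cvg_cst.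
apply/funext => m /=; rewrite seriesE addn1 big_ord_recl big1 /= ?expr0 ?mulr1 ?addr0 //.
by move=> i _; rewrite mul0r.
Unshelve. all: by end_near. Qed.

Lemma punctured_pser_exp p f n : punctured_pser p f ->
  exists q, punctured_pser q (fun x => f x ^+ n).
Proof.
move=> pf; elim: n => [|n [q qf]].
  by exists (fun k => (k == 0%N)%:R); exact: punctured_pser1.
exists (cauchy_prod p q).
rewrite (_ : (fun x => _) = (fun x => f x * f x ^+ n)); first exact: punctured_pser_mul.
by apply/funext => x; rewrite exprS.
Qed.

(** Recurrence for the reciprocal of a series with constant term 1. Each value depends on all
    earlier ones, so the step acts on whole sequences and is iterated. *)
Definition cauchy_inv_step p q (k : nat) : R :=
  if k is _.+1 then - \sum_(i < k) p (k - i)%N * q i else 1.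

(* The k-th value of an iterate of cauchy_inv_step is final after k + 1 steps *)
Definition cauchy_inv p (k : nat) : R := iter k.+1 (cauchy_inv_step p) (fun=> 0) k.

Lemma cauchy_invE p k : cauchy_inv p k = cauchy_inv_step p (cauchy_inv p) k.
Proof.
have stab j m n : (j < m)%N -> (j < n)%N ->
    iter m (cauchy_inv_step p) (fun=> 0) j = iter n (cauchy_inv_step p) (fun=> 0) j.
  elim/ltn_ind: j m n => j IHj [|m] [|n] // jm jn /=.
  case: j IHj jm jn => // j IHj jm jn; rewrite /cauchy_inv_step; congr (- _).
  apply: eq_bigr => i _; congr (_ * _).
  have ij := ltn_ord i.
  by apply: IHj => //; apply: leq_trans ij _.
rewrite {1}/cauchy_inv /=; case: k => // k; rewrite /cauchy_inv_step; congr (- _).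
by apply: eq_bigr => i _; congr (_ * _); apply: stab => //; exact: ltn_ord.
Qed.

Lemma cauchy_prod_inv p k : p 0%N = 1 -> cauchy_prod p (cauchy_inv p) k = (k == 0%N)%:R.
Proof.
move=> p0; rewrite /cauchy_prod (reindex_inj rev_ord_inj) /= big_ord_recr /=.
rewrite subSS subnn p0 mul1r subn0 cauchy_invE; case: k => [|k] /=.
  by rewrite big_ord0 add0r.
apply/eqP; rewrite subr_eq0; apply/eqP/eq_bigr => i _ /=.
have ik : (i <= k.+1)%N by rewrite ltnW // ltnS ltnW.
by rewrite subSS subKn.
Qed.

(** If |p_k| <= D^k for k > 0, induction bounds the coefficient of index k > 0 by D^k (1 + 2 + ... +
    2^(k-1)) <= (2D)^k. *)
Lemma cauchy_inv_bound p : p 0%N = 1 -> geometric_bound p -> geometric_bound (cauchy_inv p).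
Proof.
move=> p0 [C C1 pC].
have [D D1 pD] : exists2 D, 1 <= D & forall k, (0 < k)%N -> `|p k| <= D ^+ k.
  (* For positive k one has k+1 <= 2k, so the ratio C^2 absorbs the leading factor. *)
  exists (C ^+ 2); first exact: exprn_ege1.
  move=> k k0; apply: le_trans (pC k) _.
  by rewrite -exprM ler_weXn2l //; lia.
have qD k : `|cauchy_inv p k| <= (2 * D) ^+ k.
  elim/ltn_ind: k => -[_|k IHk]; first by rewrite cauchy_invE /= normr1.
  rewrite cauchy_invE /= normrN; apply: le_trans (ler_norm_sum _ _ _) _.
  apply: (@le_trans _ _ (\sum_(i < k.+1) D ^+ k.+1 * 2 ^+ i)).
    apply: ler_sum => i _; have ik := ltn_ord i.
    rewrite normrM; apply: (@le_trans _ _ (D ^+ (k.+1 - i) * (2 * D) ^+ i)).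
      by apply: ler_pM => //; [apply: pD; rewrite subn_gt0|exact: IHk].
    by rewrite exprMn mulrCA -exprD subnK 1?mulrC // ltnW.
  rewrite -mulr_sumr exprMn mulrC ler_wpM2r ?exprn_ge0 //; first by lra.
  have e : \sum_(i < k.+1) 2 ^+ i = 2 ^+ k.+1 - 1 :> R.
    rewrite subrX1 (_ : 2 - 1 = 1 :> R) ?mul1r //; lra.
  by rewrite e; lra.
exists (2 * D); first lra.
by move=> k; apply: le_trans (qD k) _; rewrite ler_weXn2l //; lra.
Qed.

(** The coefficient bound makes the reciprocal series converge near 0 to some [g]; the Cauchy
    product of both series is 1, so [g] is the inverse of [f]. *)
Lemma punctured_pser_inv p f : p 0%N = 1 -> punctured_pser p f ->
  punctured_pser (cauchy_inv p) (fun x => (f x)^-1).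
Proof.
move=> p0 [pb pf]; have qb := cauchy_inv_bound p0 pb.
pose g x := limn (series (fun k => cauchy_inv p k * x ^+ k)).
have [C C0 qC] := geometric_bound_near qb.
have qg : punctured_pser (cauchy_inv p) g.
  split=> //; near=> x; apply: (@cvg_series_geometric _ C).
  by near: x.
have [_ fg] := punctured_pser_mul (conj pb pf : punctured_pser p f) qg.
have [_ one] := punctured_pser1.
split=> //; near=> x.
have -> : (f x)^-1 = g x.
  have fgx : f x * g x = 1.
    apply: (@cvg_unique _ (@norm_hausdorff _ R) (series
      (fun k => cauchy_prod p (cauchy_inv p) k * x ^+ k) @ \oo)).
      by near: x.
    have -> : cauchy_prod p (cauchy_inv p) = (fun k => (k == 0%N)%:R).
      by apply/funext => k; rewrite cauchy_prod_inv.
    by near: x.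
  have f0 : f x != 0 by apply: contra_eq_neq fgx => ->; rewrite mul0r eq_sym oner_neq0.
  by apply: (mulfI f0); rewrite fgx divff.
by near: x; case: qg.
Unshelve. all: by end_near. Qed.

End PowerSeries.

(** * Laurent expansions and principal parts *)

Section Laurent.
Local Open Scope classical_set_scope.
Local Open Scope ring_scope.
Variable R : realType.
Implicit Types (p q : nat -> R) (f g : R -> R) (x : R) (d e : int -> R).

Definition sinc_coef (k : nat) : R := (~~ odd k)%:R * (-1) ^+ k./2 / k.+1`!%:R.

Lemma punctured_pser_sinc : punctured_pser sinc_coef (fun x => sin x / x).
Proof.
split.
  exists 1 => // k; rewrite expr1n /sinc_coef !normrM normr_nat normrX normrN1 expr1n.
  rewrite mulr1 normfV normr_nat ler_pdivrMr ?ltr0n ?fact_gt0 // mul1r.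
  by rewrite ler_nat; case: odd; rewrite //= fact_gt0.
near=> x; have x0 : x != 0 by near: x; exact: nbhs_dnbhs_neq.
have -> : series (fun k => sinc_coef k * x ^+ k) =
    (fun m => series (sin_coeff x) (m + 1)%N / x).
  apply/funext => m; rewrite !seriesE addn1 big_ord_recl /sin_coeff /= !mul0r add0r.
  rewrite mulr_suml; apply: eq_bigr => k _; rewrite /sinc_coef /bump add1n /=.
  by rewrite exprS; field; rewrite x0 pnatr_eq0 -lt0n fact_gt0.
apply: cvgM; last exact: cvg_cst.
rewrite (@cvg_shiftn 1 _ (series (sin_coeff x))) sin.unlock.
exact: (@is_cvg_series_sin_coeff R x).
Unshelve. all: by end_near. Qed.

(** sin(x)^(-n) is x^(-n) times the n-th power of the series of x / sin x. Existence gives meaning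
    to the [get] in [laurent_coef]. *)
Lemma laurent_expansion_sin n :
  exists d, laurent_expansion (fun x => sin x ^- n) d.
Proof.
have p0 : sinc_coef 0 = 1 by rewrite /sinc_coef /= expr0 mul1r divr1.
have [q [_ qE]] := punctured_pser_exp n (punctured_pser_inv p0 punctured_pser_sinc).
exists (fun j => if j < - n%:Z then 0 else q `|(j + n%:Z)%R|%N), n; split.
  by move=> j ->.
near=> x; have x0 : x != 0 by near: x; exact: nbhs_dnbhs_neq.
have -> : sin x ^- n = (sin x / x)^-1 ^+ n * x ^- n.
  by rewrite invf_div expr_div_n mulrAC mulfV ?expf_neq0 // mul1r.
rewrite (_ : series _ = (fun m => series (fun k => q k * x ^+ k) m * x ^- n)).
  apply: cvgM; last exact: cvg_cst.
  by near: x.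
apply/funext => m; rewrite !seriesE mulr_suml; apply: eq_bigr => k _.
rewrite ltrBlDr addNr ltNge /= subrK -mulrA; congr (_ * _).
by rewrite expfzDr // exprnN.
Unshelve. all: by end_near. Qed.

(** The order [M] of [laurent_expansion] is exposed, so that two expansions can be brought to a
    common order. *)
Definition laurent_from (M : nat) f d := (forall j : int, j < - M%:Z -> d j = 0) /\
  \forall x \near (0 : R)^',
    series (fun k : nat => d (k%:Z - M%:Z) * x ^ (k%:Z - M%:Z)) @ \oo --> f x.

Lemma laurent_fromD M N f d : laurent_from M f d -> laurent_from (M + N) f d.
Proof.
move=> [d0 df]; split=> [j jMN|].
  by apply: d0; apply: lt_le_trans jMN _; rewrite lerN2 lez_nat leq_addr.
near=> x; rewrite -(cvg_shiftn N).
rewrite (_ : (fun m => _) = series (fun k : nat => d (k%:Z - M%:Z) * x ^ (k%:Z - M%:Z))).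
  by near: x.
apply/funext => m; rewrite /= !seriesE addnC big_split_ord /= big1 ?add0r => [|i _].
  apply: eq_bigr => i _ /=.
  by have -> : (N + i)%:Z - (M + N)%:Z = i%:Z - M%:Z by lia.
by rewrite d0 ?mul0r //=; have := ltn_ord i; lia.
Unshelve. all: by end_near. Qed.

Lemma laurent_fromW M N f d : (M <= N)%N -> laurent_from M f d -> laurent_from N f d.
Proof. by move=> MN fd; rewrite -(subnKC MN); exact: laurent_fromD. Qed.

Lemma laurent_expansionD f g d e : laurent_expansion f d -> laurent_expansion g e ->
  laurent_expansion (fun x => f x + g x) (fun j => d j + e j).
Proof.
move=> [M fd] [N ge].
have {fd}[d0 df] := laurent_fromW (leq_maxl M N) fd.
have {ge}[e0 eg] := laurent_fromW (leq_maxr M N) ge.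
exists (maxn M N); split=> [j jM|]; first by rewrite d0 // e0 // addr0.
near=> x; rewrite (_ : series _ =
   series (fun k : nat => d (k%:Z - (maxn M N)%:Z) * x ^ (k%:Z - (maxn M N)%:Z)) \+
   series (fun k : nat => e (k%:Z - (maxn M N)%:Z) * x ^ (k%:Z - (maxn M N)%:Z))).
  by apply: cvgD; near: x.
apply/funext => m; rewrite /= !seriesE -big_split; apply: eq_bigr => k _ /=.
by rewrite mulrDl.
Unshelve. all: by end_near. Qed.

Lemma laurent_expansionZ a f d : laurent_expansion f d ->
  laurent_expansion (fun x => a * f x) (fun j => a * d j).
Proof.
move=> [M [d0 df]]; exists M; split=> [j /d0->|]; first by rewrite mulr0.
near=> x; rewrite (_ : series _ =
   (fun m => a * series (fun k : nat => d (k%:Z - M%:Z) * x ^ (k%:Z - M%:Z)) m)).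
  by apply: cvgM; [exact: cvg_cst|near: x].
apply/funext => m; rewrite !seriesE mulr_sumr; apply: eq_bigr => k _.
by rewrite mulrA.
Unshelve. all: by end_near. Qed.

Lemma laurent_expansionN n : laurent_expansion (fun x => x ^- n)
  (fun j => (j == - n%:Z)%:R).
Proof.
exists n; split=> [j jn|]; first by rewrite lt_eqF.
near=> x; rewrite -(cvg_shiftn 1) (_ : (fun m => _) = cst (x ^- n)); first exact: cvg_cst.
apply/funext => m; rewrite seriesE addn1 big_ord_recl big1 => [|i _].
  by rewrite /= sub0r eqxx mul1r addr0 exprnN.
by rewrite /= -subr_eq0 opprK subrK mul0r.
Unshelve. all: by end_near. Qed.

Lemma laurent_expansion_sum m n (f_ : nat -> R -> R) (d_ : nat -> int -> R) :
  (forall i, laurent_expansion (f_ i) (d_ i)) ->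
  laurent_expansion (fun x => \sum_(m <= i < n) f_ i x) (fun j => \sum_(m <= i < n) d_ i j).
Proof.
move=> fd; rewrite /index_iota; elim: (iota m _) => [|i s IHs].
  have -> : (fun x => \sum_(i <- [::]) f_ i x) = (fun x => 0 * x ^- 0).
    by apply/funext => x; rewrite big_nil mul0r.
  have -> : (fun j => \sum_(i <- [::]) d_ i j) = (fun j => 0 * (j == - 0%:Z)%:R).
    by apply/funext => j; rewrite big_nil mul0r.
  exact: (laurent_expansionZ 0 (laurent_expansionN 0)).
have -> : (fun x => \sum_(l <- i :: s) f_ l x) = (fun x => f_ i x + \sum_(l <- s) f_ l x).
  by apply/funext => x; rewrite big_cons.
have -> : (fun j => \sum_(l <- i :: s) d_ l j) = (fun j => d_ i j + \sum_(l <- s) d_ l j).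
  by apply/funext => j; rewrite big_cons.
exact: laurent_expansionD.
Qed.

(** Near 0 the sum is p_k x^k up to a multiple of |x|^(k+1). This tail is controlled by the
    boundedness of the terms at one point y of convergence. *)
Lemma pser_lead p (F : R -> R) k K : (forall i, (i < k)%N -> p i = 0) ->
  (\forall x \near (0 : R)^', series (fun i => p i * x ^+ i) @ \oo --> F x) ->
  (\forall x \near (0 : R)^', `|F x| <= K * `|x| ^+ k.+1) -> p k = 0.
Proof.
move=> p0 pF FK.
have [d /= d0 dP] : \forall x \near (0 : R)^',
    series (fun i => p i * x ^+ i) @ \oo --> F x /\ `|F x| <= K * `|x| ^+ k.+1.
  by near=> x; split; near: x.
have dP' x : 0 < `|x| < d ->
    series (fun i => p i * x ^+ i) @ \oo --> F x /\ `|F x| <= K * `|x| ^+ k.+1.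
  by move=> /andP[x0 xd]; apply: dP; rewrite /= ?sub0r ?normrN // -normr_gt0.
have [y y0 yd] : exists2 y : R, 0 < y & y < d by exists (d / 2); lra.
have [yF _] : series (fun i => p i * y ^+ i) @ \oo --> F y /\ `|F y| <= K * `|y| ^+ k.+1.
  by apply: dP'; rewrite gtr0_norm // y0.
have [B B0 yB] : exists2 B : R, 0 < B & forall i, `|p i * y ^+ i| <= B.
  have /pinfty_ex_gt0[B B0 BP] := cvg_series_bounded (cvgP _ yF).
  by exists B => // i; exact: BP.
(* [K] comes from the bound on [F], and 2B / y^(k+1) from the geometric tail with ratio |x| / y <=
   1/2. *)
pose L := K + 2 * B / y ^+ k.+1.
have small x : 0 < `|x| < y / 2 -> `|p k| <= L * `|x|.
  move=> /andP[x0 xy].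
  have [xF xK] : series (fun i => p i * x ^+ i) @ \oo --> F x /\ `|F x| <= K * `|x| ^+ k.+1.
    by apply: dP'; rewrite x0 /=; apply: lt_trans xy _; lra.
  pose r := `|x| / y.
  have r0 : 0 <= r by rewrite divr_ge0 // ltW.
  have r1 : r <= 1 / 2 by rewrite ler_pdivrMr //; lra.
  have xB i : `|p i * x ^+ i| <= B * r ^+ i.
    have -> : p i * x ^+ i = p i * y ^+ i * (x / y) ^+ i.
      by rewrite expr_div_n; field; rewrite expf_neq0 // gt_eqF.
    rewrite normrM ler_pM // normrX normrM normfV (gtr0_norm y0) //.
  have tail : `|F x - p k * x ^+ k| <= 2 * B * r ^+ k.+1.
    have : (fun m => `|series (fun i => p i * x ^+ i) m - p k * x ^+ k|) @ \oo
        --> `|F x - p k * x ^+ k|.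
      by apply: cvg_norm; apply: cvgB => //; exact: cvg_cst.
    move=> /ler_cvg_to; apply; first exact: (cvg_cst (2 * B * r ^+ k.+1)).
    near=> m; have km : (k.+1 <= m)%N by near: m; exact: nbhs_infty_ge.
    rewrite seriesE -(big_mkord predT (fun i => p i * x ^+ i)) (big_cat_nat (n := k.+1)) //=.
    rewrite big_nat_recr //= big_nat_cond big1 => [|i /andP[/andP[_ ik] _]]; last first.
      by rewrite p0 // mul0r.
    rewrite add0r addrAC subrr add0r; apply: le_trans (ler_norm_sum _ _ _) _.
    apply: (@le_trans _ _ (\sum_(k.+1 <= i < m) B * r ^+ i)).
      by apply: ler_sum_nat.
    have e : (1 - r) * \sum_(k.+1 <= i < m) B * r ^+ i = B * (r ^+ k.+1 - r ^+ m).
      rewrite -mulr_sumr mulrCA; congr (B * _).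
      rewrite mulr_sumr (eq_bigr (fun i => - (r ^+ i.+1 - r ^+ i))).
        by rewrite sumrN telescope_sumr // opprB.
      by move=> i _; rewrite exprS; ring.
    set S := \sum_(k.+1 <= i < m) _ in e *.
    have S0 : 0 <= S by apply: sumr_ge0 => i _; rewrite mulr_ge0 ?exprn_ge0 // ltW.
    have rS : r * S <= 1 / 2 * S by rewrite ler_wpM2r.
    have Brm : 0 <= B * r ^+ m by rewrite mulr_ge0 ?exprn_ge0 // ltW.
    by move: e; rewrite mulrBl mul1r mulrBr; lra.
  have : `|p k * x ^+ k| <= L * `|x| * `|x| ^+ k.
    have -> : p k * x ^+ k = F x - (F x - p k * x ^+ k) by ring.
    apply: le_trans (ler_normB _ _) _; rewrite -mulrA -exprS /L mulrDl.
    apply: lerD => //; apply: le_trans tail _.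
    by rewrite /r expr_div_n mulrA mulrAC.
  by rewrite normrM normrX ler_pM2r // exprn_gt0.
have : `|p k| <= 0.
  have lim0 : L * `|x| @[x --> (0 : R)^'] --> (0 : R).
    rewrite -[X in _ --> X](mulr0 L); apply: cvgM; first exact: cvg_cst.
    rewrite -[X in _ --> X](@normr0 R R); apply: cvg_norm.
    exact: cvg_within.
  apply: (@ler_cvg_to _ (0 : R)^' _ _ (fun=> `|p k|) (fun x => L * `|x|)) => //;
    first exact: cvg_cst.
  near=> x; apply: small; rewrite normr_gt0; apply/andP; split.
    by near: x; exact: nbhs_dnbhs_neq.
  by near: x; apply: dnbhs0_lt; lra.
by rewrite normr_le0 => /eqP.
Unshelve. all: by end_near. Qed.

(** x^M f is a power series, of order |x|^(k+1) whenever k + J < M; [pser_lead] kills its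
    coefficients one by one. As [d] is arbitrary, this covers the expansion picked by [get]. *)
Lemma laurent_coef_pole f d (J : nat) K : laurent_expansion f d ->
  (\forall x \near (0 : R)^', `|x ^+ J * f x| <= K) ->
  forall j : int, j < - J%:Z -> d j = 0.
Proof.
move=> [M0 fd] fK; pose M := (J + M0)%N.
have {fd}[d0 df] : laurent_from M f d by apply: laurent_fromW fd; exact: leq_addl.
pose p k := d (k%:Z - M%:Z).
suff p0 k : (k + J < M)%N -> p k = 0.
  move=> j jJ; case: (ltP j (- M%:Z)) => [/d0//|jM].
  have <- : (`|(j + M%:Z)%R|%N)%:Z - M%:Z = j by lia.
  by apply: p0; lia.
elim/ltn_ind: k => k IHk kJM.
apply: (@pser_lead p (fun x => x ^+ M * f x) k K).
- by move=> i ik; apply: IHk => //; lia.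
- near=> x; have x0 : x != 0 by near: x; exact: nbhs_dnbhs_neq.
  rewrite (_ : series _ = (fun m => x ^+ M *
      series (fun k : nat => d (k%:Z - M%:Z) * x ^ (k%:Z - M%:Z)) m)).
    by apply: cvgM; [exact: cvg_cst|near: x].
  apply/funext => m; rewrite !seriesE mulr_sumr; apply: eq_bigr => i _.
  by rewrite mulrCA /p; congr (_ * _); rewrite [x ^+ M]exprnP -expfzDr // addrCA subrr addr0.
- near=> x; have x1 : `|x| < 1 by near: x; exact: dnbhs0_lt.
  have xK : `|x ^+ J * f x| <= K by near: x.
  have -> : x ^+ M * f x = x ^+ (M - J) * (x ^+ J * f x).
    by rewrite mulrA -exprD subnK // leq_addr.
  rewrite normrM mulrC ler_pM // normrX ler_wiXn2l //; [exact: ltW|lia].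
Unshelve. all: by end_near. Qed.

End Laurent.

(** * Laurent coefficients of the powers of the cosecant *)

Section LaurentCosecant.
Local Open Scope classical_set_scope.
Local Open Scope ring_scope.
Variable R : realType.

Lemma c_coef_expansion n : exists2 d : int -> R,
  laurent_expansion (fun x => sin x ^- (2 * n)) d &
  forall i, c_coef R n i = d (- (2 * i)%:Z).
Proof.
exists (get [set d | laurent_expansion (fun x : R => sin x ^- (2 * n)) d]) => //.
have := laurent_expansion_sin R (2 * n).
exact: (@getPex _ [set d | laurent_expansion (fun x : R => sin x ^- (2 * n)) d]).
Qed.

Lemma c_coef_gt n s : (n < s)%N -> c_coef R n s = 0.
Proof.
move=> ns; have [d dE ->] := c_coef_expansion n.
apply: (@laurent_coef_pole _ _ _ (2 * n) 2 dE); last by lia.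
have lim1 : (fun x => (sin x / x)^-1 ^+ (2 * n)) @ (0 : R)^' --> (1 : R).
  rewrite -[X in _ --> X](expr1n _ (2 * n)).
  apply: (@continuous_cvg _ _ _ _ _ (fun y => (sin y / y)^-1) (fun z => z ^+ (2 * n))).
    exact: exprn_continuous.
  by rewrite -[X in _ --> X]invr1; apply: cvgV; [exact: oner_neq0|exact: cvg_sin_div].
have : \forall x \near (0 : R)^', `|(sin x / x)^-1 ^+ (2 * n)| <= 2.
  by move/cvgr_norm_le: lim1; apply; rewrite normr1 ltr1n.
by apply: filterS => x; rewrite invf_div expr_div_n.
Qed.

(** By [cot_der_csc] and [cot_der_pole], subtracting (2n-1)! x^(-2n) from the cosecant sum leaves a
    bounded function, which has no coefficients of negative degree. *)
Lemma a_coef_c_coef n s : (1 <= s <= n)%N ->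
  \sum_(1 <= i < n.+1) a_coef R n i * c_coef R i s =
  if s == n then (2 * n - 1)`!%:R else 0.
Proof.
move=> /andP[s1 sn]; have n0 : (0 < n)%N by exact: leq_trans sn.
have [d_ dE cE] : exists2 d_ : nat -> int -> R,
    forall i, laurent_expansion (fun x => sin x ^- (2 * i)) (d_ i) &
    forall i j, c_coef R i j = d_ i (- (2 * j)%:Z).
  exists (fun i => sval (cid2 (c_coef_expansion i))) => i; by case: cid2.
pose F := (2 * n - 1)`!%:R : R.
have := laurent_expansionD
  (laurent_expansion_sum 1 n.+1 (fun i => laurent_expansionZ (a_coef R n i) (dE i)))
  (laurent_expansionZ (- F) (laurent_expansionN R (2 * n))).
have [C CP] := @cot_der_pole R (2 * n - 1).
move=> /laurent_coef_pole => /(_ 0%N C).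
have bnd : \forall x \near (0 : R)^',
    `|x ^+ 0 * (\sum_(1 <= i < n.+1) a_coef R n i * sin x ^- (2 * i) + - F * x ^- (2 * n))| <= C.
  near=> x; have sx : sin x != 0 by near: x; exact: dnbhs0_sin_neq0.
  rewrite expr0 mul1r cot_der_csc // mulNr.
  have e : (2 * n = (2 * n - 1).+1)%N by lia.
  by rewrite e /F; near: x.
move=> /(_ bnd (- (2 * s)%:Z)) /= H.
have {}H : \sum_(1 <= i < n.+1) a_coef R n i * d_ i (- (2 * s)%:Z) =
    F * (- (2 * s)%:Z == - (2 * n)%:Z)%:R.
  by apply/eqP; rewrite -subr_eq0 -mulNr H //; lia.
under eq_bigr do rewrite cE.
rewrite H eqr_opp eqz_nat eqn_pmul2l // /F; case: eqP => _; last by rewrite mulr0.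
by rewrite mulr1.
Unshelve. all: by end_near. Qed.

(** By [a_coef_c_coef] the matrix [B], its rows divided by factorials, is a left inverse of [C]; for
    square matrices it is then a right inverse. The guard cuts [a_coef] down to its triangle. *)
Lemma c_coef_a_coef n j : (1 <= j <= n)%N ->
  \sum_(1 <= i < n.+1)
    c_coef R n i * (if (j <= i)%N then a_coef R i j / (2 * i - 1)`!%:R else 0) = (j == n)%:R.
Proof.
case: j => // j; case: n => // n /= jn.
pose C := \matrix_(i < n.+1, k < n.+1) c_coef R i.+1 k.+1.
pose B := \matrix_(i < n.+1, k < n.+1)
  (if (k <= i)%N then a_coef R i.+1 k.+1 / (2 * i.+1 - 1)`!%:R else 0).
have BC : B *m C = 1%:M.
  apply/matrixP => i k; rewrite !mxE.
  have -> : \sum_j0 B i j0 * C j0 k = (2 * i.+1 - 1)`!%:R^-1 *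
      \sum_(1 <= l < i.+2) a_coef R i.+1 l * c_coef R l k.+1.
    rewrite big_add1 /= big_mkord (big_ord_widen _
      (fun l => a_coef R i.+1 l.+1 * c_coef R l.+1 k.+1) (ltn_ord i)).
    rewrite mulr_sumr [RHS]big_mkcond; apply: eq_bigr => l _; rewrite !mxE ltnS.
    by case: leqP => _; [ring|rewrite mul0r].
  case: (leqP k i) => ki.
    rewrite a_coef_c_coef // eqSS [k == i :> nat]eq_sym -val_eqE /=.
    case: eqP => _; last by rewrite mulr0.
    by rewrite mulVf // pnatr_eq0 -lt0n fact_gt0.
  rewrite big_nat big1 => [|l /andP[_ li]].
    by rewrite mulr0 -val_eqE /= ltn_eqF.
  by rewrite c_coef_gt ?mulr0 // ltnS; lia.
have /matrixP/(_ ord_max (Ordinal jn)) := mulmx1C BC.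
rewrite !mxE -val_eqE /= eqSS eq_sym => <-.
by rewrite big_add1 /= big_mkord; apply: eq_bigr => i _; rewrite !mxE.
Qed.

End LaurentCosecant.

(** * Character sums *)

Section DirichletCharacter.
Variables (N : nat) (C : numFieldType) (chi : dirichlet_char N C).
Hypothesis N1 : (1 < N)%N.

Lemma dchar_dvdn (Q : nat) : (N %| Q)%N -> chi Q = 0.
Proof.
move=> NQ; rewrite /dchar_ext coprimezE /= /coprime (gcdn_idPr NQ).
by rewrite gtn_eqF.
Qed.

Lemma natr_Zp_dvdn (Q : nat) : (N %| Q)%N -> Q%:R = 0 :> 'Z_N.
Proof. by case/dvdnP => k ->; rewrite natrM pchar_Zp ?mulr0. Qed.

(** Q - j is congruent to -j modulo N, and chi(-1) = 1. *)
Lemma dchar_subn (Q j : nat) : dchar_even chi -> (N %| Q)%N -> (j <= Q)%N ->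
  chi (Q - j)%N = chi j.
Proof.
move=> ev NQ jQ.
have copE : coprime (Q - j) N = coprime j N.
  rewrite /coprime; congr (_ == 1%N); apply/eqP; rewrite eqn_dvd !dvdn_gcd !dvdn_gcdr !andbT.
  apply/andP; split.
    rewrite -(dvdn_addr _ (dvdn_gcdl (Q - j) N)) subnK //.
    exact: dvdn_trans (dvdn_gcdr _ _) NQ.
  rewrite dvdn_subr // ?dvdn_gcdl //.
  exact: dvdn_trans (dvdn_gcdr _ _) NQ.
rewrite /dchar_ext !coprimezE /= copE; case: ifP => // cj.
have := ev; rewrite /dchar_even /dchar_ext coprimezE /= coprime1n => ev1.
rewrite -[RHS]mul1r -ev1 -dcharM; congr dchar_fun; apply: val_inj.
have zE k : (k%:Z)%:~R = k%:R :> 'Z_N by [].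
rewrite !zE natrB // (natr_Zp_dvdn NQ) sub0r.
have uj : (j%:R : 'Z_N) \is a GRing.unit by rewrite unitZpE // coprime_sym.
rewrite FinRing.val_unitM !val_insubd.
by rewrite unitrN uj mulrN1z unitrN1 mulN1r.
Qed.

End DirichletCharacter.

(** * Doubling the denominator in cotangent sums *)

Section CotangentSums.
Local Open Scope complex_scope.
Variables (R : realType) (N : nat) (chi : dirichlet_char N R[i]).
Hypotheses (N1 : (1 < N)%N) (ev : dchar_even chi).

Lemma cot_der_even n (x : R) : cot_der (2 * n) (- x) = cot_der (2 * n) x.
Proof.
rewrite /cot_der sinN exprM sqrrN -exprM; congr (_ / _).
by apply: eq_bigr => l _; rewrite mulrN cosN.
Qed.

Lemma sin_frac_neq0 (j Q : nat) : (0 < j < Q)%N -> sin (j%:R * pi / Q%:R : R) != 0.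
Proof.
move=> /andP[j0 jQ]; have Q0 : 0 < Q%:R :> R by rewrite ltr0n (ltn_trans j0).
apply/lt0r_neq0/sin_gt0_pi/andP; split.
  by rewrite divr_gt0 // mulr_gt0 ?ltr0n ?pi_gt0.
by rewrite ltr_pdivrMr // mulrC ltr_pM2l ?pi_gt0 // ltr_nat.
Qed.

(** For x = j pi/Q the second argument (x - pi)/2 is -(Q - j) pi/(2Q), and [cot_der] of even index
    is even. *)
Lemma cot_der_frac n (j Q : nat) : (0 < n)%N -> (0 < j < Q)%N ->
  cot_der (2 * n) (j%:R * pi / Q%:R : R) = 2 ^- (2 * n) *
    (cot_der (2 * n) (j%:R * pi / (2 * Q)%:R) + cot_der (2 * n) ((Q - j)%:R * pi / (2 * Q)%:R)).
Proof.
move=> n0 jQ; have Q0 : Q%:R != 0 :> R by rewrite pnatr_eq0; lia.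
rewrite cot_der_duplication ?sin_frac_neq0 ?muln_gt0 //; congr (_ * (cot_der _ _ + _)).
  by rewrite natrM; field.
rewrite -[RHS]cot_der_even; congr cot_der; rewrite natrM natrB; last by lia.
by field.
Qed.

(** Range [P] and denominator [Q] are separate because after the first doubling Q = 2P, which keeps
    all angles below pi/2. *)
Definition cot_sum n (P Q : nat) : R[i] :=
  \sum_(1 <= j < P) chi j * (cot_der (2 * n) (j%:R * pi / Q%:R : R))%:C.

Lemma cot_sum_rev n P Q : (N %| P)%N ->
  \sum_(1 <= j < P) chi j * (cot_der (2 * n) ((P - j)%:R * pi / Q%:R : R))%:C =
  cot_sum n P Q.
Proof.
move=> NP; rewrite big_nat_rev; apply: eq_big_nat => j /andP[j1 jP].
by rewrite add1n subSS (dchar_subn N1 ev NP (ltnW jP)) subKn // ltnW.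
Qed.

(** At the first doubling the reflection of j to N - j identifies both halves, whence the factor
    2. *)
Lemma cot_sum_init n : (0 < n)%N ->
  cot_sum n N N = (2 ^- (2 * n) * 2)%:C * cot_sum n N (2 * N).
Proof.
move=> n0.
transitivity ((2 ^- (2 * n))%:C * (cot_sum n N (2 * N) +
  \sum_(1 <= j < N) chi j * (cot_der (2 * n) ((N - j)%:R * pi / (2 * N)%:R : R))%:C)).
  rewrite -big_split mulr_sumr; apply: eq_big_nat => j jN.
  by rewrite cot_der_frac //= -mulrDr mulrCA -rmorphD -rmorphM.
by rewrite cot_sum_rev // [(_ * 2)%:C]rmorphM rmorph_nat; ring.
Qed.

(** The reflected terms have the indices 2Q - j, from Q + 1 to 2Q - 1; the missing index Q has
    chi(Q) = 0. *)
Lemma cot_sum_double n Q : (0 < n)%N -> (0 < Q)%N -> (N %| Q)%N ->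
  cot_sum n Q (2 * Q) = (2 ^- (2 * n))%:C * cot_sum n (2 * Q) (2 * (2 * Q)).
Proof.
move=> n0 Q0 NQ.
transitivity ((2 ^- (2 * n))%:C * (cot_sum n Q (2 * (2 * Q)) +
  \sum_(1 <= j < Q) chi j * (cot_der (2 * n) ((2 * Q - j)%:R * pi / (2 * (2 * Q))%:R : R))%:C)).
  rewrite -big_split mulr_sumr; apply: eq_big_nat => j /andP[j1 jQ].
  rewrite cot_der_frac //=; last by lia.
  by rewrite -mulrDr mulrCA -rmorphD -rmorphM.
congr (_ * _); rewrite [RHS]/cot_sum [RHS](big_cat_nat (n := Q)) ?leq_pmull //=.
congr (_ + _); rewrite [RHS]big_ltn; last by lia.
rewrite dchar_dvdn // mul0r add0r -[X in index_iota X (2 * Q)]add1n [RHS]big_addn.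
rewrite [RHS]big_nat_rev (_ : (2 * Q - Q = Q)%N); last by lia.
apply: eq_big_nat => j /andP[j1 jQ].
have -> : (1 + Q - j.+1 + Q = 2 * Q - j)%N by lia.
rewrite dchar_subn //; [by apply: dvdn_mull|by lia].
Qed.

Lemma cot_sum_dyadic n r : (0 < n)%N -> cot_sum n N N =
  (2 / (2 ^+ r.+1) ^+ (2 * n))%:C * cot_sum n (N * 2 ^ r) (2 * (N * 2 ^ r)).
Proof.
move=> n0; elim: r => [|r ->]; first by rewrite expn0 muln1 expr1 cot_sum_init // [2 / _]mulrC.
rewrite cot_sum_double //; [|by rewrite muln_gt0 expn_gt0 andbT; lia|exact: dvdn_mulr].
rewrite mulrA -rmorphM expnS [in RHS]mulnCA; congr (_%:C * _).
by rewrite [2 ^+ r.+2]exprS exprMn invfM mulrA [RHS]mulrAC.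
Qed.

End CotangentSums.

(** * Dirichlet series as limits of cotangent sums *)

Section DirichletSeries.
Local Open Scope classical_set_scope.
Local Open Scope ring_scope.
Local Open Scope complex_scope.
Variables (R : realType) (N : nat) (chi : dirichlet_char N R[i]).
Hypotheses (N1 : (1 < N)%N) (ev : dchar_even chi).
Variable n : nat.
Hypothesis n0 : (0 < n)%N.

Lemma dchar_bound : exists2 b : R, 0 <= b & forall m : nat, `|chi m| <= b%:C.
Proof.
exists (\sum_(u : {unit 'Z_N}) complex.Re `|dchar_fun chi u|).
  apply: sumr_ge0 => u _.
  by have := normr_ge0 (dchar_fun chi u); rewrite lecE => /andP[].
have normE (z : R[i]) : (complex.Re `|z|)%:C = `|z| by rewrite normc_def.
move=> m; rewrite rmorph_sum /= /dchar_ext; case: ifP => _; last first.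
  by rewrite normr0 sumr_ge0 // => u _; rewrite normE.
by rewrite (bigD1 (insubd (1%g : {unit 'Z_N}) m%:~R)) //= normE lerDl sumr_ge0 // => u _;
  rewrite normE.
Qed.

Lemma cvg_sum_ord0 (u : nat -> nat -> R) m : (forall j, u j @ \oo --> (0 : R)) ->
  (fun r => \sum_(j < m) u j r) @ \oo --> (0 : R).
Proof.
move=> u0; elim: m => [|m IHm].
  by under eq_fun do rewrite big_ord0; exact: cvg_cst.
rewrite (_ : (fun r => _) = (fun r => \sum_(j < m) u j r) \+ u m); last first.
  by apply/funext => r; rewrite big_ord_recr.
by rewrite -[X in _ --> X]addr0; apply: cvgD.
Qed.

(** Telescoping, from 1/j^2 <= 1/(j-1) - 1/j. *)
Lemma sum_inv_sqr_le (m P : nat) : (0 < m)%N ->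
  \sum_(m.+1 <= j < P) j%:R ^- 2 <= m%:R^-1 :> R.
Proof.
move=> m0; have [Pm|mP] := leqP P m.+1; first by rewrite big_geq // invr_ge0.
suff : \sum_(m.+1 <= j < P) j%:R ^- 2 <= m%:R^-1 - P.-1%:R^-1 :> R.
  by have : 0 <= P.-1%:R^-1 :> R; [rewrite invr_ge0|lra].
have {mP} : (m < P)%N by exact: ltnW.
elim: P => // P IHP; rewrite ltnS leq_eqVlt => /predU1P[<-|mP].
  by rewrite big_geq //= subrr.
rewrite big_nat_recr //=.
have := IHP mP; case: P mP {IHP} => // P mP /= IHP.
have P1 : (0 < P)%N by lia.
have P0 : 0 < P%:R :> R by rewrite ltr0n.
have : P.+1%:R ^- 2 <= P%:R^-1 - P.+1%:R^-1 :> R.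
  have -> : P%:R^-1 - P.+1%:R^-1 = (P%:R * P.+1%:R)^-1 :> R.
    by rewrite -natr1; field; rewrite gt_eqF //= gt_eqF //; lra.
  rewrite lef_pV2 ?posrE ?mulr_gt0 ?exprn_gt0 ?ltr0n //.
  by rewrite expr2 ler_pM2r ?ltr0n // ler_nat.
by move: (P.+1%:R ^- 2) (P.+1%:R^-1) => u v uv; rewrite (le_trans (lerD IHP uv)) // addrA subrK.
Qed.

(** Apart from chi(j) and a global factor 2, the dyadic sum at level r has the terms
    [w j * phi (y r j)], where the weight is free of r and the second factor tends to [F]. *)
Let w (j : nat) : R := (j%:R * pi / N%:R) ^- (2 * n).
Let y (r j : nat) : R := j%:R * pi / (2 * (N * 2 ^ r))%:R.
Let phi (x : R) : R := x ^+ (2 * n) * cot_der (2 * n) x.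
Let F : R := (2 * n - 1)`!%:R.

Let N0 : 0 < N%:R :> R. Proof. by rewrite ltr0n ltnW. Qed.

Let e2n : (2 * n = (2 * n - 1).+1)%N. Proof. by lia. Qed.

Let w_ge0 j : 0 <= w j.
Proof. by rewrite invr_ge0 exprn_ge0 // divr_ge0 ?mulr_ge0 ?pi_ge0. Qed.

Let w_le j : w j <= w 1 * j%:R ^- 2.
Proof.
case: j => [|j];
  first by rewrite /w mul0r mul0r expr0n muln_eq0 (gtn_eqF n0) /= invr0 mulr_ge0 //
    ?w_ge0 // invr_ge0 exprn_ge0.
have -> : w j.+1 = w 1 * j.+1%:R ^- (2 * n).
  rewrite /w mul1r -mulrA exprMn invfM mulrC //.
rewrite ler_wpM2l // lef_pV2 ?posrE ?exprn_gt0 ?ltr0n //.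
by rewrite ler_weXn2l ?ler1n //; lia.
Qed.

Let dyadic r : cot_sum chi n N N =
  2 * \sum_(1 <= j < N * 2 ^ r) chi j * (w j * phi (y r j))%:C.
Proof.
rewrite (cot_sum_dyadic N1 ev r n0) /cot_sum !mulr_sumr.
apply: eq_big_nat => j /andP[j1 jP].
have -> : w j * phi (y r j) = cot_der (2 * n) (y r j) / 2 ^+ r.+1 ^+ (2 * n).
  have -> : w j = (y r j * 2 ^+ r.+1) ^- (2 * n).
    by rewrite /w /y !natrM natrX exprS; congr (_ ^- _); field;
      rewrite (lt0r_neq0 N0) expf_neq0 ?pnatr_eq0.
  have y0 : y r j != 0.
    by rewrite mulf_neq0 ?invr_eq0 ?mulf_neq0 ?pnatr_eq0 ?gt_eqF ?pi_gt0 //; lia.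
  by rewrite /phi [in LHS]exprMn; field; rewrite !expf_neq0.
rewrite -/(y r j); move: (cot_der _ _) (_ ^- _) => g q.
by rewrite !rmorphM rmorph_nat -mulrA; congr (_ * _); rewrite mulrCA; congr (_ * _); exact: mulrC.
Qed.

Let phi_le r j : (0 < j < N * 2 ^ r)%N -> `|phi (y r j)| <= (2 / cos 1) ^+ (2 * n) * F.
Proof.
move=> /andP[j0 jP]; rewrite /phi {1 2}e2n [in X in _ <= X]e2n; apply: cot_der_le.
have P0 : 0 < (N * 2 ^ r)%:R :> R by rewrite ltr0n (leq_trans _ jP).
have -> : y r j = j%:R / (N * 2 ^ r)%:R * (pi / 2).
  by rewrite /y natrM; move: (N * 2 ^ r)%:R P0 => P P0; field; rewrite lt0r_neq0.
have pi2 : 0 < pi / 2 :> R by rewrite divr_gt0 ?pi_gt0.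
apply/andP; split; first by rewrite mulr_gt0 // divr_gt0 // ltr0n.
by rewrite ler_piMl ?(ltW pi2) // ler_pdivrMr // mul1r ler_nat ltnW.
Qed.

Let phi_cvg j : (0 < j)%N -> phi (y r j) @[r --> \oo] --> F.
Proof.
move=> j0; have -> : phi = (fun x => x ^+ (2 * n - 1).+1 * cot_der (2 * n - 1).+1 x).
  by rewrite -e2n.
have yE r : y r j = j%:R * pi / (2 * N%:R) * 2^-1 ^+ r.
  by rewrite /y !natrM natrX exprVn; field; rewrite (lt0r_neq0 N0) expf_neq0 ?pnatr_eq0.
have y0 r : y r j != 0.
  by rewrite yE !mulf_neq0 ?invr_eq0 ?mulf_neq0 ?expf_neq0 ?invr_eq0 ?pnatr_eq0
    ?(lt0r_neq0 (pi_gt0 R)) //; lia.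
have ycvg : y r j @[r --> \oo] --> (0 : R).
  have gcvg : (fun r => j%:R * pi / (2 * N%:R) * 2^-1 ^+ r) @ \oo -->
    (j%:R * pi / (2 * N%:R) * 0 : R).
    apply: cvgM; first exact: cvg_cst.
    by apply: cvg_expr; rewrite ger0_norm; lra.
  by rewrite mulr0 in gcvg; under eq_fun do rewrite yE.
(* Since [y r j] is never 0, its limit can be taken in the punctured neighbourhoods. *)
have ycvg' : y r j @[r --> \oo] --> (0 : R)^'.
  move=> A A0.
  have Ay : \forall r \near \oo, y r j != 0 -> A (y r j) := ycvg _ A0.
  by apply: filterS Ay => r; apply; exact: y0.
exact: (cvg_comp _ _ ycvg' (@cot_der_cvg R (2 * n - 1))).
Qed.

Let K : R := (2 / cos 1) ^+ (2 * n) * F.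

(** Dominated convergence with a rate: as r grows, the terms up to m tend to those of the series,
    while for every r the others sum to at most a multiple of the sum of 1/j^2 over j > m, hence of
    1/m. *)
Let tannery : exists2 B : R, 0 <= B & forall m, (0 < m)%N ->
  `|cot_sum chi n N N - 2 * \sum_(1 <= j < m.+1) chi j * (w j * F)%:C| <= (B / m%:R)%:C.
Proof.
have [b b0 chib] := dchar_bound.
have K0 : 0 <= K.
  rewrite mulr_ge0 ?ler0n // exprn_ge0 // divr_ge0 // ltW //; exact: cos1_gt0.
have wK0 : 0 <= w 1 * K by rewrite mulr_ge0 // w_ge0.
exists (2 * b * (w 1 * K)); first by rewrite mulr_ge0 // mulr_ge0.
move=> m m0; set D := _ - _.
pose e r : R := \sum_(1 <= j < m.+1) w j * `|phi (y r j) - F|.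
have D_le r : (m < N * 2 ^ r)%N ->
    `|D| <= (2 * b * (e r + w 1 * K * m%:R^-1))%:C.
  move=> mP.
  have -> : D = 2 * \sum_(1 <= j < N * 2 ^ r)
      chi j * (w j * (phi (y r j) - (if (j < m.+1)%N then F else 0)))%:C.
    rewrite /D (dyadic r) -mulrBr; congr (_ * _).
    rewrite [X in X - _](big_cat_nat (n := m.+1)) //= [RHS](big_cat_nat (n := m.+1)) //= addrAC.
    congr (_ + _).
      rewrite -sumrB; apply: eq_big_nat => j /andP[_ jm].
      by rewrite jm -mulrBr -rmorphB -mulrBr.
    by apply: eq_big_nat => j /andP[mj _]; rewrite ltnNge mj /= subr0.
  rewrite normrM normr_nat -mulrA rmorphM rmorph_nat ler_wpM2l //.
  apply: le_trans (ler_norm_sum _ _ _) _.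
  apply: (@le_trans _ _ (\sum_(1 <= j < N * 2 ^ r)
     (b * (w j * `|phi (y r j) - (if (j < m.+1)%N then F else 0)|))%:C)).
    apply: ler_sum_nat => j _; rewrite normrM [(b * _)%:C]rmorphM ler_pM //.
    have normR (x : R) : `|x%:C| = `|x|%:C.
      by rewrite normc_def /= expr0n addr0 sqrtr_sqr.
    by rewrite normR normrM ger0_norm.
  rewrite -rmorph_sum lecR -mulr_sumr ler_wpM2l //.
  rewrite (big_cat_nat (n := m.+1)) //=; apply: lerD.
    by rewrite le_eqVlt; apply/orP; left; apply/eqP; apply: eq_big_nat => j /andP[_ ->].
  apply: (@le_trans _ _ (\sum_(m.+1 <= j < N * 2 ^ r) w 1 * K * j%:R ^- 2)).
    apply: ler_sum_nat => j /andP[mj jP]; rewrite ltnNge mj /= subr0 [w 1 * K]mulrC -mulrA mulrC.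
    by apply: ler_pM => //; [apply: phi_le; rewrite jP andbT; lia].
  by rewrite -mulr_sumr ler_wpM2l // sum_inv_sqr_le.
(* [D] does not depend on r, so letting r grow removes the contribution [e r] of the first m
   terms. *)
have e_cvg : 2 * b * (e r + w 1 * K * m%:R^-1) @[r --> \oo]
  --> (2 * b * (0 + w 1 * K * m%:R^-1) : R).
  apply: cvgM; first exact: cvg_cst.
  apply: cvgD; last exact: cvg_cst.
  rewrite (_ : e = fun r => \sum_(j < m) w j.+1 * `|phi (y r j.+1) - F|); last first.
    by apply/funext => r; rewrite /e big_add1 big_mkord.
  apply: (@cvg_sum_ord0 (fun j r => w j.+1 * `|phi (y r j.+1) - F|)) => j.
  rewrite -[X in _ --> X](mulr0 (w j.+1)); apply: cvgM; first exact: cvg_cst.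
  apply/norm_cvg0P; rewrite -[X in _ --> X](subrr F).
  by apply: cvgB; [exact: phi_cvg|exact: cvg_cst].
have DE : `|D| = (complex.Re `|D|)%:C by rewrite normc_def.
rewrite add0r mulrA in e_cvg.
rewrite DE lecR; apply: (@ler_cvg_to _ \oo _ _ (fun=> complex.Re `|D|) _ _ _ _ e_cvg).
  exact: cvg_cst.
near=> r; rewrite -lecR -DE; apply: D_le.
have mr : (m <= r)%N by near: r; exact: nbhs_infty_ge.
apply: (leq_ltn_trans mr); apply: (leq_trans (ltn_expl r (ltnSn 1))).
by rewrite leq_pmull // ltnW.
Unshelve. all: by end_near. Qed.

(** The factor [c] is such that 2 c F times [w j] is j^(-2n), so [tannery] bounds the distance to
    the partial sums by a multiple of 1/m. *)
Lemma dirichlet_L_cot_sum : dirichlet_L chi (2 * n) =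
  (pi ^+ (2 * n) / (2 * (2 * n - 1)`!%:R * N%:R ^+ (2 * n)) : R)%:C * cot_sum chi n N N.
Proof.
set c := _ / _.
have c0 : 0 < c.
  by rewrite divr_gt0 ?mulr_gt0 ?exprn_gt0 ?pi_gt0 // ltr0n fact_gt0.
have [B B0 BE] := tannery.
apply: (@cvg_lim (R[i]^o) (@norm_hausdorff _ (R[i]^o))).
have termE j : (0 < j)%N -> c%:C * (2 * (chi j * (w j * F)%:C)) = chi j / j%:R ^+ (2 * n).
  move=> j0; have -> : (j%:R ^+ (2 * n))^-1 = ((j%:R ^- (2 * n) : R))%:C :> R[i].
    by rewrite fmorphV rmorphXn rmorph_nat.
  have -> : j%:R ^- (2 * n) = c * (2 * (w j * F)) :> R.
    have F0 : F != 0 by rewrite pnatr_eq0 -lt0n fact_gt0.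
    have j0' : j%:R != 0 :> R by rewrite pnatr_eq0 -lt0n.
    have p0 := lt0r_neq0 (pi_gt0 R); have N0' := lt0r_neq0 N0.
    rewrite /c -/F /w expr_div_n exprMn.
    by field; apply/and4P; split; rewrite ?expf_neq0.
  move: (w j * F) (c) => X Y.
  by rewrite !rmorphM rmorph_nat; ring.
have near_bound m : (0 < m)%N ->
    `|c%:C * cot_sum chi n N N - \sum_(1 <= j < m.+1) chi j / j%:R ^+ (2 * n)| <=
    (c * B / m%:R)%:C.
  move=> m0; have := BE m m0.
  have -> : \sum_(1 <= j < m.+1) chi j / j%:R ^+ (2 * n) =
      c%:C * (2 * \sum_(1 <= j < m.+1) chi j * (w j * F)%:C).
    by rewrite !mulr_sumr; apply: eq_big_nat => j /andP[j0 _]; rewrite termE.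
  have normc' : `|c%:C| = c%:C by rewrite ger0_norm // ler0c ltW.
  by rewrite -mulrBr normrM normc' -[c * B / _]mulrA [(c * _)%:C]rmorphM => H;
    rewrite ler_wpM2l // ler0c ltW.
apply/cvgrPdist_le => eps eps0.
(* Tolerances live in R[i]; positivity there forces [eps] to be real. *)
have [e0 epsE] : 0 < complex.Re eps /\ eps = (complex.Re eps)%:C.
  move: eps0; rewrite ltcE => /andP[/eqP im re]; split=> //.
  by case: eps im re => a b /= ->.
near=> m.
have m1 : (Num.bound (c * B / complex.Re eps) < m)%N by near: m; exact: nbhs_infty_gt.
have m2 : (1 < m)%N by near: m; exact: nbhs_infty_gt.
(* The partial sums of [dirichlet_L] stop before m, so the bound is used at m - 1. *)
have -> : m = m.-1.+1 by lia.
have m0 : (0 < m.-1)%N by lia.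
apply: le_trans (near_bound _ m0) _.
rewrite epsE lecR ler_pdivrMr ?ltr0n // [complex.Re eps * _]mulrC -ler_pdivrMr //.
have A0 : 0 <= c * B / complex.Re eps.
  by apply: divr_ge0 (ltW e0); apply: mulr_ge0 (ltW c0) B0.
apply: ltW; apply: (lt_le_trans (archi_boundP A0)); rewrite ler_nat; lia.
Unshelve. all: by end_near. Qed.
End DirichletSeries.

(** * From cotangent sums to the L-function of the cycle graph *)

Lemma cot_sum_cycle_L (R : realType) (N n : nat) (chi : dirichlet_char N R[i]%C) :
  (0 < n)%N -> cot_sum chi n N N = \sum_(1 <= i < n.+1) (a_coef R n i)%:C%C * cycle_L chi i.
Proof.
move=> n0; rewrite /cycle_L; under [RHS]eq_bigr do rewrite mulr_sumr.
rewrite exchange_big_nat; apply: eq_big_nat => m mN.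
rewrite -cot_der_csc ?sin_frac_neq0 // rmorph_sum /= mulr_sumr.
apply: eq_bigr => i _.
by rewrite rmorphM fmorphV mulrCA.
Qed.

Local Open Scope complex_scope.

Theorem theorem1 (R : realType) (N : nat) (hN : (2 <= N)%N)
    (chi : dirichlet_char N R[i]) (hchi : dchar_even chi)
    (n : nat) (hn : (1 <= n)%N) :
  [/\ dirichlet_L chi (2 * n) =
        (pi ^+ (2 * n) / (2 * (2 * n - 1)`!%:R * N%:R ^+ (2 * n)) : R)%:C
        * \sum_(1 <= i < n.+1) (a_coef R n i)%:C * cycle_L chi i,
      cycle_L chi n =
        2 * \sum_(1 <= i < n.+1)
              (c_coef R n i * (N%:R ^+ (2 * i) / pi ^+ (2 * i)))%:C
              * dirichlet_L chi (2 * i)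
    & forall s : nat, (1 <= s <= n)%N ->
        \sum_(0 <= i < (n - s).+1) a_coef R n (n - i) * c_coef R (n - i) s =
        if s == n then (2 * n - 1)`!%:R else 0].
Proof.
have LE k : (1 <= k)%N -> dirichlet_L chi (2 * k) =
    (pi ^+ (2 * k) / (2 * (2 * k - 1)`!%:R * N%:R ^+ (2 * k)) : R)%:C
    * \sum_(1 <= i < k.+1) (a_coef R k i)%:C * cycle_L chi i.
  by move=> k1; rewrite dirichlet_L_cot_sum // cot_sum_cycle_L.
split; first exact: LE.
  (* [cycle_L chi n] is the sum over j of a Kronecker delta times [cycle_L chi j], the delta being
     expanded by [c_coef_a_coef]. *)
  transitivity (\sum_(1 <= i < n.+1) \sum_(1 <= j < n.+1) (c_coef R n i *
      (if (j <= i)%N then a_coef R i j / (2 * i - 1)`!%:R else 0))%:C * cycle_L chi j).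
    rewrite exchange_big_nat /= (eq_big_nat _ _ (F2 := fun j => (j == n)%:R * cycle_L chi j)).
      rewrite big_nat_recr //= eqxx mul1r big_nat big1 ?add0r // => j /andP[_ jn].
      by rewrite ltn_eqF // mul0r.
    move=> j jn; rewrite -mulr_suml -rmorph_sum /= c_coef_a_coef //.
    by rewrite rmorph_nat.
  rewrite mulr_sumr; apply: eq_big_nat => i /andP[i1 iln].
  (* The guard removes the indices j > i; what remains is the first formula at i. *)
  rewrite LE // (big_cat_nat (n := i.+1)) //= [X in _ + X]big_nat_cond [X in _ + X]big1 ?addr0.
    rewrite !mulr_sumr; apply: eq_big_nat => j /andP[_ ji].
    have F0 : (2 * i - 1)`!%:R != 0 :> R by rewrite pnatr_eq0 -lt0n fact_gt0.
    have N0 : N%:R != 0 :> R by rewrite pnatr_eq0; lia.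
    have p0 := lt0r_neq0 (pi_gt0 R).
    rewrite -ltnS ji; move: (c_coef R n i) (a_coef R i j) (_`!%:R) F0 => c a F F0.
    have -> : c * (a / F) = 2 * (c * (N%:R ^+ (2 * i) / pi ^+ (2 * i)) *
        (pi ^+ (2 * i) / (2 * F * N%:R ^+ (2 * i)) * a)).
      by field; rewrite F0 !expf_neq0.
    move: (c * (N%:R ^+ (2 * i) / pi ^+ (2 * i)))
      (pi ^+ (2 * i) / (2 * F * N%:R ^+ (2 * i))) => u v.
    by rewrite !rmorphM rmorph_nat -!mulrA.
  move=> j /andP[/andP[ij _] _]; rewrite leqNgt ij /= mulr0 mul0r //.
(* Indices below s contribute nothing by [c_coef_gt]; reversing the remaining range gives the
   indices n - i. *)
move=> s sn; rewrite -a_coef_c_coef // [RHS](big_cat_nat (n := s)) /=; [|by lia|by lia].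
rewrite [X in _ = X + _]big_nat_cond [X in _ = X + _]big1 ?add0r.
  rewrite -[X in index_iota X n.+1]add0n big_addn [RHS]big_nat_rev /= subSn; last by lia.
  apply: eq_big_nat => i ins.
  by rewrite (_ : 0 + (n - s).+1 - i.+1 + s = n - i)%N //; lia.
by move=> i /andP[/andP[_ is_] _]; rewrite c_coef_gt ?mulr0.
Qed.
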